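(* Let $n\ge 2$ be an integer. The following problem is $\Pi^1_1$-hard: given a timed Büchi automaton $\mathcal{A}$ with $n$ clocks, determine whether there exists a timed Büchi automaton $\mathcal{B}$ with $n-1$ clocks such that $L_\omega(\mathcal{B})=L_\omega(\mathcal{A})$.
   Context: $\mathcal{R}$ denotes the set of positive reals. An infinite timed word over a finite alphabet $\Sigma$ is a sequence $t_1.a_1.t_2.a_2\ldots$ with $t_i\in\mathcal{R}$ and $a_i\in\Sigma$. A timed Büchi automaton (Alur–Dill) has finitely many real-valued clocks (growing at rate 1), finitely many states with initial states and a set of accepting states, and finitely many transitions each labelled by a letter of $\Sigma$, carrying a diagonal-free clock guard (Boolean combination of constraints $x\sim c$, $c$ a nonnegative integer) and a set of clocks to reset; an infinite timed word is accepted if some run on it visits accepting states infinitely often, and $L_\omega(\mathcal{A})$ is the set of accepted infinite timed words. $\Pi^1_1$ is the corresponding class of the analytical hierarchy; a problem is $\Pi^1_1$-hard if every $\Pi^1_1$ set reduces to it. *)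

(* Defs.v *)
From Stdlib Require List.
From HB Require Import structures.
From mathcomp Require Import all_boot all_order all_algebra.
From mathcomp Require Import boolp classical_sets reals.

Set Implicit Arguments.
Unset Strict Implicit.
Unset Printing Implicit Defensive.

Import Order.TTheory GRing.Theory Num.Theory.

(** * Total recursive functions *)

(* The class of general recursive functions: minimization is only applied to
   regular functions, so all members are total.  The defining equations are
   pointwise, hence the class is closed under extensional equality. *)
Inductive recursive : forall k : nat, (k.-tuple nat -> nat) -> Prop :=
| rec_zero k (f : k.-tuple nat -> nat) :
    (forall v, f v = 0) -> recursive f
| rec_succ (f : 1.-tuple nat -> nat) :
    (forall v, f v = (thead v).+1) -> recursive f
| rec_proj k (i : 'I_k) (f : k.-tuple nat -> nat) :
    (forall v, f v = tnth v i) -> recursive f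
| rec_comp k m (g : m.-tuple nat -> nat) (h : 'I_m -> k.-tuple nat -> nat)
    (f : k.-tuple nat -> nat) :
    recursive g -> (forall i, recursive (h i)) ->
    (forall v, f v = g [tuple h i v | i < m]) -> recursive f
| rec_prim k (g : k.-tuple nat -> nat) (h : k.+2.-tuple nat -> nat)
    (f : k.+1.-tuple nat -> nat) :
    recursive g -> recursive h ->
    (forall v : k.-tuple nat, f [tuple of 0 :: v] = g v) ->
    (forall y (v : k.-tuple nat), f [tuple of y.+1 :: v] =
                 h [tuple of y :: f [tuple of y :: v] :: v]) ->
    recursive f
| rec_mu k (g : k.+1.-tuple nat -> nat) (f : k.-tuple nat -> nat) :
    recursive g ->
    (forall v : k.-tuple nat, g [tuple of f v :: v] = 0) ->
    (forall (v : k.-tuple nat) y, y < f v -> g [tuple of y :: v] <> 0) ->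
    recursive f.

(** * The class Pi^1_1 *)

(* Arithmetical formulas (no function quantifier) with number variables
   (de Bruijn indices) and unary function variables. *)
Inductive term : Type :=
| TVar of nat
| TZero
| TSucc of term
| TAdd of term & term
| TMul of term & term
| TApp of nat & term.

Inductive formula : Type :=
| FEq of term & term
| FNot of formula
| FAnd of formula & formula
| FOr of formula & formula
| FAll of formula
| FEx of formula.

Fixpoint teval (F : nat -> nat -> nat) (e : seq nat) (t : term) : nat :=
  match t with
  | TVar i => nth 0 e i
  | TZero => 0
  | TSucc t => (teval F e t).+1
  | TAdd t u => teval F e t + teval F e u
  | TMul t u => teval F e t * teval F e u
  | TApp j t => F j (teval F e t)
  end.

Fixpoint sat (F : nat -> nat -> nat) (e : seq nat) (p : formula) : Prop :=
  match p with
  | FEq t u => teval F e t = teval F e u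
  | FNot p => ~ sat F e p
  | FAnd p q => sat F e p /\ sat F e q
  | FOr p q => sat F e p \/ sat F e q
  | FAll p => forall y : nat, sat F (y :: e) p
  | FEx p => exists y : nat, sat F (y :: e) p
  end.

(* Quantifying over all assignments F of the function variables amounts to
   universally quantifying the finitely many function variables of p. *)
Definition Pi11 (S : nat -> Prop) : Prop :=
  exists p : formula,
    forall x, S x <-> (forall F : nat -> nat -> nat, sat F [:: x] p).

(* Many-one hardness for a problem P whose instances are the elements of T,
   presented to algorithms through the numbering code. *)
Definition Pi11_hard (T : Type) (code : T -> nat) (P : T -> Prop) : Prop :=
  forall S : nat -> Prop, Pi11 S ->
    exists f : nat -> T,
      recursive (fun v : 1.-tuple nat => code (f (thead v))) /\
      (forall x, S x <-> P (f x)).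

(** * Timed Buchi automata *)

Inductive cmp : Type := CLt | CLe | CEq | CGe | CGt.

Inductive guard (n : nat) : Type :=
| GTrue
| GCmp of 'I_n & cmp & nat
| GNot of guard n
| GAnd of guard n & guard n
| GOr of guard n & guard n.

Arguments GTrue {n}.

Record transition (k n m : nat) := Transition {
  src : 'I_m;
  letter : 'I_k;
  tguard : guard n;
  resets : {set 'I_n};
  dst : 'I_m
}.

(* k = size of the alphabet 'I_k, n = number of clocks. *)
Record tba (k n : nat) := TBA {
  nstates : nat;
  initial : {set 'I_nstates};
  accepting : {set 'I_nstates};
  trans : seq (transition k n nstates)
}.

Section Semantics.

Variable R : realType.

Definition cmp_sat (x : R) (op : cmp) (c : nat) : bool :=
  match op with
  | CLt => (x < c%:R)%R
  | CLe => (x <= c%:R)%R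
  | CEq => x == c%:R%R
  | CGe => (x >= c%:R)%R
  | CGt => (x > c%:R)%R
  end.

Fixpoint guard_sat (n : nat) (v : 'I_n -> R) (g : guard n) : bool :=
  match g with
  | GTrue => true
  | GCmp x op c => cmp_sat (v x) op c
  | GNot g => ~~ guard_sat v g
  | GAnd g h => guard_sat v g && guard_sat v h
  | GOr g h => guard_sat v g || guard_sat v h
  end.

Definition delay n (v : 'I_n -> R) (t : R) : 'I_n -> R := fun x => (v x + t)%R.

Definition reset n (v : 'I_n -> R) (X : {set 'I_n}) : 'I_n -> R :=
  fun x => if x \in X then 0%R else v x.

(* w i is the pair (t_{i+1}, a_{i+1}); t_{i+1} is the time elapsed between
   the i-th and the (i+1)-st letters.  Zeno words are allowed. *)
Definition timed_word (k : nat) (w : nat -> R * 'I_k) : Prop :=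
  forall i, (0 < (w i).1)%R.

Definition step k n (A : tba k n) (q : 'I_(nstates A)) (v : 'I_n -> R)
    (t : R) (a : 'I_k) (q' : 'I_(nstates A)) (v' : 'I_n -> R) : Prop :=
  exists e : transition k n (nstates A),
    [/\ List.In e (trans A), src e = q /\ dst e = q', letter e = a,
        guard_sat (delay v t) (tguard e)
      & v' = reset (delay v t) (resets e)].

Definition is_run k n (A : tba k n) (w : nat -> R * 'I_k)
    (q : nat -> 'I_(nstates A)) (v : nat -> 'I_n -> R) : Prop :=
  [/\ q 0 \in initial A, v 0 = (fun=> 0%R)
    & forall i, step (q i) (v i) (w i).1 (w i).2 (q i.+1) (v i.+1)].

Definition L_omega k n (A : tba k n) : set (nat -> R * 'I_k) :=
  [set w | timed_word w /\
     exists (q : nat -> 'I_(nstates A)) (v : nat -> 'I_n -> R),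
       is_run w q v /\
       (forall N : nat, exists2 i : nat, N <= i & q i \in accepting A)]%classic.

End Semantics.

Arguments L_omega R {k n} A.

(** * Numbering of automata *)

(* CodeSeq.code is the standard effective bijection from seq nat to nat. *)

Definition code_set (m : nat) (X : {set 'I_m}) : nat :=
  CodeSeq.code [seq nat_of_ord x | x <- enum X].

Definition code_cmp (op : cmp) : nat :=
  match op with CLt => 0 | CLe => 1 | CEq => 2 | CGe => 3 | CGt => 4 end.

Fixpoint code_guard n (g : guard n) : nat :=
  match g with
  | GTrue => CodeSeq.code [:: 0]
  | GCmp x op c => CodeSeq.code [:: 1; nat_of_ord x; code_cmp op; c]
  | GNot g => CodeSeq.code [:: 2; code_guard g]
  | GAnd g h => CodeSeq.code [:: 3; code_guard g; code_guard h]
  | GOr g h => CodeSeq.code [:: 4; code_guard g; code_guard h]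
  end.

Definition code_transition k n m (e : transition k n m) : nat :=
  CodeSeq.code [:: nat_of_ord (src e); nat_of_ord (letter e);
                   code_guard (tguard e); code_set (resets e);
                   nat_of_ord (dst e)].

Definition code_tba k n (A : tba k n) : nat :=
  CodeSeq.code [:: k; n; nstates A; code_set (initial A);
                   code_set (accepting A);
                   CodeSeq.code [seq code_transition e | e <- trans A]].

(* Main.v *)
Require Import Defs.
From HB Require Import structures.
From mathcomp Require Import all_boot all_order all_algebra.
From mathcomp Require Import boolp classical_sets reals.
From mathcomp Require Import lra zify.

Set Implicit Arguments.
Unset Strict Implicit.
Unset Printing Implicit Defensive.

Import Order.TTheory GRing.Theory Num.Theory.

(**
A Pi^1_1 set is the complement of the set of [x] such that [F |= ~ p(x)] for
some functions [F].  With a pairing function, truth predicates for the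
subformulas and Skolem functions, this becomes the solvability of a finite
system of equations [f_a (f_b k) = f_c k], and of conditional equalities
between the values [f_a k], for unary functions [f_a] on the integers.

A solution is written on a triangle: row [i] has cells [0, ..., i-1], and some
rows are records of the tuple [(f_a k)_a] for some [k], the name [a] standing
in cell [f_a k]; every [k] is recorded infinitely often.  A timed word encodes
a triangle when row [i] takes one time unit and each column sits at a fixed
fractional time.  A clock reset at each event of a column follows that column
from row to row; hence two clocks suffice to guess two columns and two rows and
to detect that an equation fails at them, or that the word is not such an
encoding.  The union of these detectors accepts all timed words iff the system
has no solution, and [x] occurs in it only as a constant of a guard.

Finally all this is run after a prefix of [2n+1] events, or else the prefix is
required to have its event [n+i] exactly one time unit after its event [i] for
each [i < n].  If the detectors are not universal, no automaton with [n-1] clocks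
accepts this language: on a prefix with generic times some event [i < n] is not
the last reset of a clock at event [n+i], and moving it slightly goes unnoticed.
*)

(** * Recursive functions *)

(** A detector has two clocks, and a clock can follow one column only. This fixes the shape of the
    equations: [f_a (f_b k) = f_c k] links a record of [k] to a record of [f_b k], that is two
    columns in two rows, while a conditional equality at one [k] is visible inside a single row
    without clocks. Truth must therefore become a unary function of a coded environment. Detectors
    only look forward, so a violation is seen only if a record of [f_b k] comes after one of [k];
    this is why every record has to recur. That a column is free of [idn] from some row on is
    detected by guessing it and never leaving the last position. Rows grow because a row has
    finitely many events while values are unbounded; a record waits for a row that is long enough.
    The prefix consists of [n] starting events, [n] closing events and one event at which the
    detectors reset all clocks and begin afresh. In the lower bound the suffix is one fixed word
    without violation, started later than the largest constant of the smaller automaton, so that the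
    guards of the suffix do not see the moved event either. *)

Definition recursive1 (g : nat -> nat) : Prop :=
  recursive (fun v : 1.-tuple nat => g (thead v)).

Lemma recursive1_comp (g h : nat -> nat) :
  recursive1 g -> recursive1 h -> recursive1 (fun x => g (h x)).
Proof.
move=> rg rh; apply: (@rec_comp 1 1 _ (fun _ => _) _ rg) => [i|v]; first exact: rh.
by rewrite /thead tnth_mktuple.
Qed.

Lemma recursive1_id : recursive1 id.
Proof. exact: (@rec_proj 1 ord0). Qed.

Lemma recursive1_succ : recursive1 succn.
Proof. exact: rec_succ. Qed.

Lemma recursive1_const c : recursive1 (fun=> c).
Proof.
elim: c => [|c IHc]; first exact: rec_zero.
exact: (recursive1_comp recursive1_succ IHc).
Qed.

Definition recursive2 (g : nat -> nat -> nat) : Prop :=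
  recursive (fun v : 2.-tuple nat => g (thead v) (tnth v ord_max)).

Lemma recursive2_comp (k : nat) (g : nat -> nat -> nat) (h1 h2 : k.-tuple nat -> nat) :
  recursive2 g -> recursive h1 -> recursive h2 ->
  recursive (fun v => g (h1 v) (h2 v)).
Proof.
move=> rg r1 r2.
apply: (@rec_comp k 2 _ (fun i v => if i == ord0 then h1 v else h2 v) _ rg) => [i|v].
  by case: (i == ord0).
by rewrite /thead !tnth_mktuple.
Qed.

Lemma recursive2_add : recursive2 addn.
Proof.
pose h := fun v : 3.-tuple nat => (tnth v (inord 1)).+1.
have rh : recursive h.
  apply: (@rec_comp 3 1 (fun v => (thead v).+1) (fun _ v => tnth v (inord 1))).
  - exact: rec_succ.
  - by move=> i; apply: (@rec_proj 3 (inord 1)).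
  - by move=> v; rewrite /thead tnth_mktuple.
apply: (@rec_prim 1 (fun v => thead v) h) => //.
- exact: recursive1_id.
- by move=> v; rewrite /thead !(tnth_nth 0).
- by move=> y v; rewrite /h /thead !(tnth_nth 0) /= inordK // addSn.
Qed.

(** The step by which [CodeSeq.code] conses [n] onto a list with code [m]; it also serves as the
    pairing function of the arithmetic below. *)
Definition code_cons (n m : nat) := 2 ^ n * m.*2.+1.

Lemma recursive2_code_cons : recursive2 code_cons.
Proof.
pose g := fun v : 1.-tuple nat => (thead v + thead v).+1.
have rg : recursive g.
  apply: (@recursive1_comp succn (fun x => x + x)); first exact: recursive1_succ.
  by apply: (@recursive2_comp 1 addn); [exact: recursive2_add|exact: recursive1_id|
    exact: recursive1_id].
pose h := fun v : 3.-tuple nat => tnth v (inord 1) + tnth v (inord 1).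
have rh : recursive h.
  by apply: (@recursive2_comp 3 addn); [exact: recursive2_add|exact: (@rec_proj 3 (inord 1))|exact: (@rec_proj 3 (inord 1))].
(* Recursion on the exponent: the value at 0 is [2m+1], and each step doubles it. *)
apply: (rec_prim rg rh) => [v|y v].
  by rewrite /g /code_cons /thead !(tnth_nth 0) /= expn0 mul1n addnn.
rewrite /h /code_cons /thead !(tnth_nth 0) /= inordK //= expnS -mulnA mul2n.
by rewrite addnn.
Qed.

Lemma recursive1_code (I : Type) (s : seq I) (g : I -> nat -> nat) :
  (forall i, recursive1 (g i)) ->
  recursive1 (fun x => CodeSeq.code [seq g i x | i <- s]).
Proof.
move=> rg; elim: s => [|i s IHs]; first exact: recursive1_const.
exact: (recursive2_comp recursive2_code_cons (rg i) IHs).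
Qed.

Lemma recursive1_code_nth (s : seq (nat -> nat)) :
  (forall i, recursive1 (nth (fun=> 0) s i)) ->
  recursive1 (fun x => CodeSeq.code [seq g x | g <- s]).
Proof.
elim: s => [|g s IHs] rg; first exact: recursive1_const.
exact: (recursive2_comp recursive2_code_cons (rg 0) (IHs (fun i => rg i.+1))).
Qed.

(** * Arithmetical truth as a system of equations between unary functions *)

(** The projections of [code_cons]. At 0, which is not a value of [code_cons], both give 0, so 0
    codes the zero stream. *)
Definition code_hd (k : nat) : nat := logn 2 k.
Definition code_tl (k : nat) : nat := (k %/ 2 ^ logn 2 k)./2.

Lemma code_consK1 y e : code_hd (code_cons y e) = y.
Proof.
rewrite /code_hd /code_cons lognM ?expn_gt0 // pfactorK //.
by rewrite lognE /= dvdn2 /= odd_double /= addn0.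
Qed.

Lemma code_consK2 y e : code_tl (code_cons y e) = e.
Proof.
rewrite /code_tl -/(code_hd _) code_consK1 /code_cons mulKn ?expn_gt0 //.
by rewrite /= uphalf_double.
Qed.

(** Only two shapes, since two clocks must suffice to refute each: [Comp] compares two columns in
    two rows, and [Cond] compares cells of one row. *)
Inductive constraint (N : Type) : Type :=
| Comp of N & N & N
| Cond of bool & N & bool & N & N.

Definition holds N (f : N -> nat -> nat) (c : constraint N) : Prop :=
  match c with
  | Comp a b c => forall k, f a (f b k) = f c k
  | Cond z p e a b => forall k, (f p k == 0) = z -> (f a k == f b k) = e
  end.

Arguments holds : simpl never.

Fixpoint holds_all N (f : N -> nat -> nat) (cs : seq (constraint N)) : Prop :=
  if cs is c :: cs' then holds f c /\ holds_all f cs' else True.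

Lemma holds_all_cat N (f : N -> nat -> nat) cs1 cs2 :
  holds_all f (cs1 ++ cs2) <-> holds_all f cs1 /\ holds_all f cs2.
Proof. by elim: cs1 => [|c cs1 /= ->]; intuition. Qed.

Lemma holds_all_In N (f : N -> nat -> nat) cs :
  holds_all f cs <-> forall c, List.In c cs -> holds f c.
Proof.
elim: cs => [|c cs /= ->]; first by split.
by split=> [[fc fcs] c' [<-|/fcs] //|fcs]; split=> [|c' c'cs]; apply: fcs; auto.
Qed.

Definition solves N (zero idn succ inp : N) (cs : seq (constraint N)) (x : nat)
    (f : N -> nat -> nat) : Prop :=
  [/\ forall k, f zero k = 0, forall k, f idn k = k, forall k, f succ k = k.+1,
      forall k, f inp k = x & holds_all f cs].

Inductive base : Type :=
| BZero | BSucc | BId | BIn | BHd | BTl | BIncHd | BCons0 | BDecHd | BSum | BMul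
| BMulArg | BInput
| BFun of nat
| BPair of term & term
| BTruth of formula
| BWit of formula.

Inductive expr : Type := EBase of base | EComp of expr & expr.

Coercion EBase : base >-> expr.

Fixpoint eval (f : base -> nat -> nat) (e : expr) (k : nat) : nat :=
  match e with
  | EBase b => f b k
  | EComp e1 e2 => eval f e1 (eval f e2 k)
  end.

(** An unconditional equation is a conditional one whose condition tests [BZero], which always
    vanishes. *)
Definition ceq (a b : expr) : constraint expr := @Cond expr true BZero true a b.
Definition czero (p a b : expr) : constraint expr := @Cond expr true p true a b.
Definition cpos (p a b : expr) : constraint expr := @Cond expr false p true a b.

(** Pairing is axiomatized by [BHd] and [BTl], which need not be the standard projections: [BCons0]
    and [BIncHd] build codes, and [BDecHd] drives a recursion on the head. It turns iterated
    successors into [BSum], and iterated sums into [BMul], where [BMulArg] forms the pair to be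
    added. *)
Definition core_constraints : seq (constraint expr) := [::
  ceq (EComp BHd BZero) BZero; ceq (EComp BTl BZero) BZero;
  ceq (EComp BHd BIncHd) (EComp BSucc BHd); ceq (EComp BTl BIncHd) BTl;
  ceq (EComp BHd BCons0) BZero; ceq (EComp BTl BCons0) BId;
  ceq (EComp BTl BDecHd) BTl; cpos BHd (EComp BSucc (EComp BHd BDecHd)) BHd;
  czero BHd BSum BTl; cpos BHd BSum (EComp BSucc (EComp BSum BDecHd));
  czero BHd BMul BZero; cpos BHd BMul (EComp BSum BMulArg);
  ceq (EComp BHd BMulArg) BTl; ceq (EComp BTl BMulArg) (EComp BMul BDecHd)].

(** Names denote unary functions, so a binary operation is applied to the pair of its arguments,
    which gets a name [BPair t u] of its own. *)
Fixpoint term_expr (t : term) : expr :=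
  match t with
  | TVar i => EComp BHd (iter i (EComp BTl) BId)
  | TZero => BZero
  | TSucc t => EComp BSucc (term_expr t)
  | TAdd t u => EComp BSum (BPair t u)
  | TMul t u => EComp BMul (BPair t u)
  | TApp j t => EComp (BFun j) (term_expr t)
  end.

Definition pair_constraints (t u : term) : seq (constraint expr) :=
  [:: ceq (EComp BHd (BPair t u)) (term_expr t);
      ceq (EComp BTl (BPair t u)) (term_expr u)].

Fixpoint term_constraints (t : term) : seq (constraint expr) :=
  match t with
  | TSucc t | TApp _ t => term_constraints t
  | TAdd t u | TMul t u =>
      pair_constraints t u ++ term_constraints t ++ term_constraints u
  | _ => [::]
  end.

(** A nonzero value of [BTruth] means true. For a quantifier, a code [k] is an environment of the
    body and its tail one of the whole formula: the constraint at all [k] gives one implication, and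
    the Skolem function [W], which extends [k] by a witness or a counterexample, gives the other. *)
Fixpoint formula_constraints (p : formula) : seq (constraint expr) :=
  let T := BTruth p in let W := BWit p in
  match p with
  | FEq t u => [:: @Cond expr false T true (term_expr t) (term_expr u);
                  @Cond expr true T false (term_expr t) (term_expr u)]
               ++ term_constraints t ++ term_constraints u
  | FNot q => [:: @Cond expr true (BTruth q) false T BZero; cpos (BTruth q) T BZero]
              ++ formula_constraints q
  | FAnd q r => [:: czero (BTruth q) T BZero; cpos (BTruth q) T (BTruth r)]
                ++ formula_constraints q ++ formula_constraints r
  | FOr q r => [:: czero (BTruth q) T (BTruth r); @Cond expr false (BTruth q) false T BZero]
               ++ formula_constraints q ++ formula_constraints r
  | FAll q => [:: ceq (EComp BTl W) BId; czero (BTruth q) (EComp T BTl) BZero;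
                 czero T (EComp (BTruth q) W) BZero] ++ formula_constraints q
  | FEx q => [:: ceq (EComp BTl W) BId;
                @Cond expr false (BTruth q) false (EComp T BTl) BZero;
                @Cond expr false T false (EComp (BTruth q) W) BZero] ++ formula_constraints q
  end.

(** [BInput] codes the environment [[:: x]]: its tail is 0, the zero stream, in agreement with the
    default 0 of [nth] in [teval]. *)
Definition input_constraints (p : formula) : seq (constraint expr) :=
  [:: ceq (EComp BHd BInput) BIn; ceq (EComp BTl BInput) BZero;
     @Cond expr true BZero false (EComp (BTruth p) BInput) BZero].

Definition truth_constraints (p : formula) : seq (constraint expr) :=
  core_constraints ++ formula_constraints p ++ input_constraints p.

(* [sat F e] only depends on [nth 0 e]; as streams, environments of all lengths
   are coded by iterating [code_hd] and [code_tl]. *)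
Definition scons (y : nat) (s : nat -> nat) : nat -> nat :=
  fun i => if i is j.+1 then s j else y.

Fixpoint steval (F : nat -> nat -> nat) (s : nat -> nat) (t : term) : nat :=
  match t with
  | TVar i => s i
  | TZero => 0
  | TSucc t => (steval F s t).+1
  | TAdd t u => steval F s t + steval F s u
  | TMul t u => steval F s t * steval F s u
  | TApp j t => F j (steval F s t)
  end.

Fixpoint ssat (F : nat -> nat -> nat) (s : nat -> nat) (p : formula) : Prop :=
  match p with
  | FEq t u => steval F s t = steval F s u
  | FNot p => ~ ssat F s p
  | FAnd p q => ssat F s p /\ ssat F s q
  | FOr p q => ssat F s p \/ ssat F s q
  | FAll p => forall y : nat, ssat F (scons y s) p
  | FEx p => exists y : nat, ssat F (scons y s) p
  end.

Lemma tevalE F e t : teval F e t = steval F (nth 0 e) t.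
Proof. by elim: t => //= [t ->|t -> u ->|t -> u ->|j t ->]. Qed.

Lemma nth_cons_scons y e : nth 0 (y :: e) = scons y (nth 0 e).
Proof. by apply/funext => -[]. Qed.

Lemma satE F p : forall e, sat F e p <-> ssat F (nth 0 e) p.
Proof.
elim: p => [t u|p IHp|p IHp q IHq|p IHp q IHq|p IHp|p IHp] e /=.
- by rewrite !tevalE.
- by rewrite IHp.
- by rewrite IHp IHq.
- by rewrite IHp IHq.
- by split=> Hp y; move: (Hp y); rewrite IHp nth_cons_scons.
- by split=> -[y]; [rewrite IHp|rewrite -nth_cons_scons -IHp] => Hp; exists y;
    rewrite -?nth_cons_scons.
Qed.

(** * Soundness: every solution of the system computes arithmetical truth *)

Section TruthSound.

Variables (f : base -> nat -> nat).
Hypothesis zeroE : forall k, f BZero k = 0.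
Hypothesis idE : forall k, f BId k = k.
Hypothesis succE : forall k, f BSucc k = k.+1.

Lemma holds_ceq a b : holds (eval f) (ceq a b) <-> eval f a =1 eval f b.
Proof.
by split=> [ab k|ab k _]; [apply/eqP/ab; rewrite /= zeroE|apply/eqP/ab].
Qed.

Lemma holds_czero p a b :
  holds (eval f) (czero p a b) <-> (forall k, eval f p k = 0 -> eval f a k = eval f b k).
Proof. by split=> ab k /eqP pk; apply/eqP/ab. Qed.

Lemma holds_cpos p a b :
  holds (eval f) (cpos p a b) <-> (forall k, eval f p k <> 0 -> eval f a k = eval f b k).
Proof.
by split=> ab k; [move/eqP/negbTE => pk; apply/eqP/ab|move/negbT/eqP => pk; apply/eqP/ab].
Qed.

Let stream k i := f BHd (iter i (f BTl) k).

Hypothesis core : holds_all (eval f) core_constraints.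

(** [BCons0] provides the head 0, and [BIncHd] raises it to [y]. *)
Lemma core_cons y e : exists k, f BHd k = y /\ f BTl k = e.
Proof.
case: core => _ [_ [/holds_ceq /= h1 [/holds_ceq /= h2 [/holds_ceq /= h3 [/holds_ceq /= h4 _]]]]].
elim: y => [|y [k [ky ke]]]; first by exists (f BCons0 e); rewrite h3 h4 zeroE idE.
by exists (f BIncHd k); rewrite h1 h2 succE ky.
Qed.

Lemma core_sum k : f BSum k = f BHd k + f BTl k.
Proof.
case: core => _ [_ [_ [_ [_ [_ [/holds_ceq /= h1 [/holds_cpos /= h2
  [/holds_czero /= h3 [/holds_cpos /= h4 _]]]]]]]]].
have [y ky] : exists y, f BHd k = y by exists (f BHd k).
elim: y k ky => [|y IHy] k ky; first by rewrite h3 ky.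
have dky : f BHd (f BDecHd k) = y by apply: succn_inj; rewrite -succE h2 ky.
by rewrite h4 ?ky // succE IHy // dky h1 addSn.
Qed.

Lemma core_mul k : f BMul k = f BHd k * f BTl k.
Proof.
case: core => _ [_ [_ [_ [_ [_ [/holds_ceq /= h1 [/holds_cpos /= h2
  [_ [_ [/holds_czero /= h5 [/holds_cpos /= h6 [/holds_ceq /= h7 [/holds_ceq /= h8 _]]]]]]]]]]]]].
have [y ky] : exists y, f BHd k = y by exists (f BHd k).
elim: y k ky => [|y IHy] k ky; first by rewrite h5 ky ?zeroE.
have dky : f BHd (f BDecHd k) = y by apply: succn_inj; rewrite -succE h2 ky.
by rewrite h6 ?ky // core_sum h7 h8 IHy // dky h1 mulSn.
Qed.

Lemma stream_scons k : stream k = scons (f BHd k) (stream (f BTl k)).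
Proof. by apply/funext => -[|i] //=; rewrite /stream iterSr. Qed.

Lemma iter_exprE i k : eval f (iter i (EComp BTl) BId) k = iter i (f BTl) k.
Proof. by elim: i => [|i IHi] /=; rewrite ?idE ?IHi. Qed.

Let F j := f (BFun j).

Lemma term_exprE t : holds_all (eval f) (term_constraints t) ->
  forall k, eval f (term_expr t) k = steval F (stream k) t.
Proof.
elim: t => [i _ k|_ k|t IHt ct k|t IHt u IHu|t IHt u IHu|j t IHt ct k] /=.
- by rewrite iter_exprE.
- by rewrite zeroE.
- by rewrite succE IHt.
- rewrite holds_all_cat => -[/holds_ceq /= hE [/holds_ceq /= tE [ct cu]]] k.
  by rewrite core_sum hE tE IHt // IHu.
- rewrite holds_all_cat => -[/holds_ceq /= hE [/holds_ceq /= tE [ct cu]]] k.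
  by rewrite core_mul hE tE IHt // IHu.
- by rewrite IHt.
Qed.

Lemma truthE p : holds_all (eval f) (formula_constraints p) ->
  forall k, f (BTruth p) k <> 0 <-> ssat F (stream k) p.
Proof.
elim: p => [t u|p IHp|p IHp q IHq|p IHp q IHq|p IHp|p IHp] /=.
- rewrite holds_all_cat => -[h1 [h2 [ct cu]]] k.
  have := h1 k; have := h2 k; rewrite !term_exprE //=.
  case: (f _ k) => [|m] h3 h4; split=> //.
  + by move/eqP; rewrite h3.
  + by move=> _; apply/eqP; rewrite h4.
- move=> [h1 [/holds_cpos h2 cp]] k; rewrite -IHp //.
  have := h1 k; have := h2 k; rewrite /= zeroE.
  case: (f _ k) => [|m] h3 h4; split.
  + by move=> _.
  + by move=> _ h; have := h4 erefl; rewrite h.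
  + by rewrite h3.
  + by move=> h; case: h.
- rewrite holds_all_cat => -[/holds_czero /= h1 [/holds_cpos /= h2 [cp cq]]] k.
  rewrite -IHp // -IHq //; case E: (f (BTruth p) k) => [|m].
    by rewrite h1 // zeroE; split=> [|[]].
  by rewrite h2 ?E //; split=> [|[]].
- rewrite holds_all_cat => -[/holds_czero /= h1 [h2 [cp cq]]] k.
  rewrite -IHp // -IHq //; case E: (f (BTruth p) k) => [|m].
    by rewrite h1 //; split=> [|[]]; auto.
  split=> _; first by left.
  by have := h2 k; rewrite /= E zeroE => /(_ erefl)/eqP.
- move=> [/holds_ceq /= h1 [/holds_czero /= h2 [/holds_czero /= h3 cp]]] k; split.
    move=> Tk y; have [k' [<- k'k]] := core_cons y k.
    rewrite -{1}k'k -stream_scons -IHp // => Tk'.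
    by apply: Tk; rewrite -k'k h2 // zeroE.
  move=> Hp Tk; have := h3 _ Tk; rewrite zeroE; apply/(IHp cp).
  by rewrite stream_scons h1 idE.
- move=> [/holds_ceq /= h1 [h2 [h3 cp]]] k; split.
    move=> /eqP/negbTE Tk; have /= /negbT := h3 _ Tk; rewrite zeroE => /eqP/(IHp cp).
    by rewrite stream_scons h1 idE => ?; exists (f BHd (f (BWit (FEx p)) k)).
  move=> [y]; have [k' [<- k'k]] := core_cons y k.
  rewrite -{1}k'k -stream_scons -IHp // => /eqP/negbTE Tk'.
  by have /= /negbT := h2 _ Tk'; rewrite zeroE k'k => /eqP.
Qed.

Lemma truth_sound p x : (forall k, f BIn k = x) ->
  holds_all (eval f) (formula_constraints p) ->
  holds_all (eval f) (input_constraints p) -> ssat F (nth 0 [:: x]) p.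
Proof.
move=> inE cp [/holds_ceq /= h1 [/holds_ceq /= h2 [h3 _]]].
have [/holds_ceq /= h4 [/holds_ceq /= h5 _]] := core.
have <- : stream (f BInput 0) = nth 0 [:: x].
  rewrite stream_scons h1 inE h2 zeroE nth_cons_scons; congr scons.
  apply/funext => i; rewrite nth_nil /stream.
  have -> : iter i (f BTl) 0 = 0 by elim: i => //= i ->; have := h5 0; rewrite zeroE.
  by have := h4 0; rewrite zeroE.
apply/truthE => //; have /= := h3 0; rewrite zeroE => /(_ erefl)/negbT.
by move/eqP.
Qed.

End TruthSound.

(** * Completeness: the standard solution of the system *)

Section TruthComplete.

Variables (F : nat -> nat -> nat) (x : nat).

Let stream k i := code_hd (iter i code_tl k).

Definition wit (P : nat -> Prop) : nat :=
  if pselect (exists y, P y) is left h then projT1 (cid h) else 0.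

Lemma witP (P : nat -> Prop) : (exists y, P y) -> P (wit P).
Proof. by rewrite /wit; case: pselect => // h _; case: cid. Qed.

Definition truth_fun (b : base) (k : nat) : nat :=
  match b with
  | BZero => 0
  | BSucc => k.+1
  | BId => k
  | BIn => x
  | BHd => code_hd k
  | BTl => code_tl k
  | BIncHd => code_cons (code_hd k).+1 (code_tl k)
  | BCons0 => code_cons 0 k
  | BDecHd => code_cons (code_hd k).-1 (code_tl k)
  | BSum => code_hd k + code_tl k
  | BMul => code_hd k * code_tl k
  | BMulArg => code_cons (code_tl k) ((code_hd k).-1 * code_tl k)
  | BInput => code_cons x 0
  | BFun j => F j k
  | BPair t u => code_cons (steval F (stream k) t) (steval F (stream k) u)
  | BTruth p => `[< ssat F (stream k) p >]
  | BWit (FEx p) => code_cons (wit (fun y => ssat F (scons y (stream k)) p)) k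
  | BWit (FAll p) => code_cons (wit (fun y => ~ ssat F (scons y (stream k)) p)) k
  | BWit _ => 0
  end.

Let codeK := (code_consK1, code_consK2).

Lemma truth_core : holds_all (eval truth_fun) core_constraints.
Proof.
do !split; try (by move=> k /= _; rewrite ?codeK ?eqxx).
- by move=> k /=; case: (code_hd k) => // m _; rewrite codeK /= eqxx.
- by move=> k /= /eqP ->; rewrite add0n eqxx.
- by move=> k /=; case: (code_hd k) => // m _; rewrite !codeK /= eqxx.
- by move=> k /= /eqP ->; rewrite mul0n eqxx.
- by move=> k /=; case: (code_hd k) => // m _; rewrite !codeK /= mulSn eqxx.
Qed.

Lemma code_stream_scons k : stream k = scons (code_hd k) (stream (code_tl k)).
Proof. by apply/funext => -[|i] //=; rewrite /stream iterSr. Qed.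

Lemma stream_code_cons y k : stream (code_cons y k) = scons y (stream k).
Proof. by rewrite code_stream_scons !codeK. Qed.

Lemma truth_term_exprE t k : eval truth_fun (term_expr t) k = steval F (stream k) t.
Proof.
elim: t => [i|//|t /= -> //|t _ u _|t _ u _|j t /= -> //] /=; rewrite ?codeK //.
by rewrite iter_exprE.
Qed.

Lemma truth_term t : holds_all (eval truth_fun) (term_constraints t).
Proof.
elim: t => // t ct u cu; rewrite /= holds_all_cat; do !split=> //;
  by apply/holds_ceq => // k; rewrite truth_term_exprE /= codeK.
Qed.

Lemma truth_formula p : holds_all (eval truth_fun) (formula_constraints p).
Proof.
have bE b : (nat_of_bool b == 0) = ~~ b by case: b.
elim: p => [t u|p IHp|p IHp q IHq|p IHp q IHq|p IHp|p IHp] /=;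
  rewrite ?holds_all_cat; do !split=> //.
- move=> k; rewrite !truth_term_exprE /= bE => /negbFE/asboolP ->.
  by rewrite eqxx.
- move=> k; rewrite !truth_term_exprE /= bE => /asboolP ?.
  exact/eqP.
- exact: truth_term.
- exact: truth_term.
- by move=> k /=; rewrite !bE => /asboolP ?; apply/negbF/asboolP.
- by move=> k /=; rewrite !bE => /negbFE/asboolP ?; apply/asboolP; apply.
- by move=> k /=; rewrite !bE => /asboolP ?; apply/asboolP => -[].
- move=> k /=; rewrite !bE => /negbFE/asboolP ?; apply/eqP; congr nat_of_bool.
  by apply/asboolP/asboolP => [[]|] //.
- move=> k /=; rewrite !bE => /asboolP ?; apply/eqP; congr nat_of_bool.
  by apply/asboolP/asboolP => [[]|] //; right.
- by move=> k /=; rewrite !bE => /negbFE/asboolP ?; apply/negbF/asboolP; left.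
- by apply/holds_ceq => // k /=; rewrite codeK.
- move=> k /=; rewrite !bE => /asboolP np; apply/asboolP => /(_ (code_hd k)).
  by rewrite -code_stream_scons.
- move=> k /=; rewrite !bE => /asboolP/existsNP/witP np; apply/asboolP.
  by rewrite stream_code_cons.
- by apply/holds_ceq => // k /=; rewrite codeK.
- move=> k /=; rewrite !bE => /negbFE/asboolP np; apply/negbF/asboolP.
  by exists (code_hd k); rewrite -code_stream_scons.
- move=> k /=; rewrite !bE => /negbFE/asboolP/witP np; apply/negbF/asboolP.
  by rewrite stream_code_cons.
Qed.

Lemma truth_input p : ssat F (nth 0 [:: x]) p ->
  holds_all (eval truth_fun) (input_constraints p).
Proof.
move=> Hp; do !split; try by apply/holds_ceq => // k /=; rewrite codeK.
move=> k _ /=; apply/negbTE; rewrite eqb0 negbK; apply/asboolP.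
suff -> : stream (code_cons x 0) = nth 0 [:: x] by [].
rewrite stream_code_cons nth_cons_scons; congr scons; apply/funext => i.
rewrite nth_nil /stream; have -> : iter i code_tl 0 = 0 by elim: i => //= i ->.
by rewrite /code_hd logn0.
Qed.

End TruthComplete.

Lemma truth_system p x :
  (exists F, sat F [:: x] p) <->
  (exists f, [/\ forall k, f BZero k = 0, forall k, f BId k = k,
      forall k, f BSucc k = k.+1, forall k, f BIn k = x
    & holds_all (eval f) (truth_constraints p)]).
Proof.
split=> [[F /satE Hp]|[f [h1 h2 h3 h4]]].
  exists (truth_fun F x); split=> //; rewrite !holds_all_cat; split; first exact: truth_core.
  by split; [exact: truth_formula|exact: truth_input].
rewrite !holds_all_cat => -[h5 [h6 h7]]; exists (fun j => f (BFun j)).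
exact/satE/truth_sound.
Qed.

Lemma In_cat (T : Type) (x : T) s1 s2 :
  List.In x (s1 ++ s2) <-> List.In x s1 \/ List.In x s2.
Proof. exact: List.in_app_iff. Qed.

Lemma In_map (T U : Type) (h : T -> U) y s :
  List.In y (map h s) <-> exists2 x, List.In x s & y = h x.
Proof.
elim: s => [|x s IHs] /=; first by split=> // -[].
rewrite IHs; split=> [[<-|[z zs ->]]|[z [->|zs] ->]]; [by exists x; auto|by exists z; auto|
  by left|by right; exists z].
Qed.

Lemma In_mem (T : eqType) (x : T) s : List.In x s <-> x \in s.
Proof.
elim: s => //= y s IHs; rewrite inE IHs; split=> [[->|->]|/orP[/eqP->|]];
  rewrite ?eqxx ?orbT; auto.
Qed.

(** Classical equality on expressions, enough for [index] to number them. *)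
HB.instance Definition _ := gen_eqMixin expr.

Fixpoint subexprs (e : expr) : seq expr :=
  e :: (if e is EComp a b then subexprs a ++ subexprs b else [::]).

Lemma subexprs_refl e : e \in subexprs e.
Proof. by case: e => *; rewrite /= mem_head. Qed.

Lemma subexprs_comp a b e : EComp a b \in subexprs e ->
  (a \in subexprs e) && (b \in subexprs e).
Proof.
elim: e => [c|e1 IH1 e2 IH2] /=; first by rewrite inE => /eqP.
rewrite !inE !mem_cat => /orP[/eqP[-> ->]|/orP[/IH1|/IH2] /andP[-> ->]];
  by rewrite ?subexprs_refl ?orbT.
Qed.

Definition constraint_names N (c : constraint N) : seq N :=
  match c with Comp a b c => [:: a; b; c] | Cond _ p _ a b => [:: p; a; b] end.

Definition cmap N M (h : N -> M) (c : constraint N) : constraint M :=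
  match c with
  | Comp a b c => Comp (h a) (h b) (h c)
  | Cond z p e a b => Cond z (h p) e (h a) (h b)
  end.

Lemma holds_cmap N M (h : N -> M) (f : N -> nat -> nat) (g : M -> nat -> nat) c :
  (forall a, List.In a (constraint_names c) -> g (h a) =1 f a) ->
  holds g (cmap h c) <-> holds f c.
Proof.
case: c => [a b c|z p e a b] /= fg.
  have fa := fg a (or_introl erefl); have fb := fg b (or_intror (or_introl erefl)).
  have fc := fg c (or_intror (or_intror (or_introl erefl))).
  by split=> /= H k; move: (H k); rewrite fb fa fc.
have fa := fg p (or_introl erefl); have fb := fg a (or_intror (or_introl erefl)).
have fc := fg b (or_intror (or_intror (or_introl erefl))).
by split=> /= H k; move: (H k); rewrite fb fa fc.
Qed.

(** * Reduction to finitely many names, as needed for a finite alphabet *)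

Section FiniteNames.

Variable cs : seq (constraint expr).

Definition exprs : seq expr :=
  flatten (map subexprs ([:: EBase BZero; EBase BId; EBase BSucc; EBase BIn]
                         ++ flatten (map (@constraint_names _) cs))).

(** The additional index [size exprs] is shared by all expressions outside [exprs]. *)
Definition name_of (e : expr) : 'I_(size exprs).+1 := inord (index e exprs).

Lemma name_ofK e : e \in exprs -> nth (EBase BZero) exprs (name_of e) = e.
Proof. by move=> ee; rewrite inordK ?nth_index // ltnS index_size. Qed.

Lemma exprs_names c e : List.In c cs -> List.In e (constraint_names c) -> e \in exprs.
Proof.
move=> cc ec; rewrite /exprs map_cat flatten_cat mem_cat; apply/orP; right.
elim: cs cc => //= c' cs' IH; rewrite map_cat flatten_cat mem_cat.
case=> [->|/IH ->]; last by rewrite orbT.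
apply/orP; left; elim: (constraint_names c) ec => //= e' s IHs; rewrite mem_cat.
by case=> [->|/IHs ->]; rewrite ?subexprs_refl ?orbT.
Qed.

Lemma exprs_comp a b : EComp a b \in exprs -> (a \in exprs) && (b \in exprs).
Proof.
case/flatten_mapP => e ee /subexprs_comp/andP[ha hb].
by apply/andP; split; apply/flatten_mapP; exists e.
Qed.

Lemma exprs_special :
  [&& EBase BZero \in exprs, EBase BId \in exprs, EBase BSucc \in exprs
    & EBase BIn \in exprs].
Proof. by rewrite /exprs /= !inE !eqxx !orbT. Qed.

(** Naming every subexpression turns nested compositions into [Comp] constraints. A base name obeys
    no equation, so its slot is filled by a constraint that always holds. *)
Definition comp_constraint (e : expr) : constraint 'I_(size exprs).+1 :=
  match e with
  | EComp a b => Comp (name_of a) (name_of b) (name_of e)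
  | EBase _ => Cond true (name_of e) true (name_of e) (name_of e)
  end.

Definition finite_constraints :=
  map (cmap name_of) cs ++ map comp_constraint exprs.

Lemma finite_names x :
  (exists f, [/\ forall k, f BZero k = 0, forall k, f BId k = k,
      forall k, f BSucc k = k.+1, forall k, f BIn k = x
    & holds_all (eval f) cs]) <->
  exists f, solves (name_of BZero) (name_of BId) (name_of BSucc) (name_of BIn)
              finite_constraints x f.
Proof.
have /and4P[e0 e1 e2 e3] := exprs_special.
split=> [[f [h0 h1 h2 h3 h4]]|[g [h0 h1 h2 h3 h4]]].
  exists (fun i => eval f (nth (EBase BZero) exprs i)).
  split; [by move=> k; rewrite name_ofK //= h0|by move=> k; rewrite name_ofK //= h1|
    by move=> k; rewrite name_ofK //= h2|by move=> k; rewrite name_ofK //= h3|].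
  apply/holds_all_In => c /In_cat[] /In_map[].
    move=> c' c'c ->; apply/(holds_cmap (f := eval f)) => [a ac k|].
      by rewrite name_ofK // (exprs_names c'c).
    by move/holds_all_In: h4; apply.
  case=> [b|a b] /In_mem ee -> k; first by rewrite eqxx.
  by have /andP[ea eb] := exprs_comp ee; rewrite !name_ofK.
exists (fun b => g (name_of b)); split=> //.
pose f b := g (name_of (EBase b)); rewrite -/f.
have gE e : e \in exprs -> g (name_of e) =1 eval f e.
  elim: e => // a IHa b IHb eab k; have /andP[ea eb] := exprs_comp eab.
  rewrite /= -IHa // -IHb //; move/holds_all_In: h4 => /(_ (comp_constraint (EComp a b))).
  move=> H; apply/esym/H; apply/In_cat; right; apply/In_map; exists (EComp a b) => //.
  exact/In_mem.
apply/holds_all_In => c cc; apply/(holds_cmap (h := name_of) (g := g)) => [a ac|].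
  by apply: gE; exact: (exprs_names cc).
by move/holds_all_In: h4; apply; apply/In_cat; left; apply/In_map; exists c.
Qed.

End FiniteNames.

(** Names and constraints depend on [p] alone, so the alphabet and the shape of the detectors are
    the same for all [x]. *)
Lemma arithmetic_system p :
  exists (m : nat) (zero idn succ inp : 'I_m) (cs : seq (constraint 'I_m)),
    forall x, (exists F, sat F [:: x] p) <->
              exists f, solves zero idn succ inp cs x f.
Proof.
exists (size (exprs (truth_constraints p))).+1; do 5 eexists; move=> x.
by apply: iff_trans (truth_system p x) _; exact: finite_names.
Qed.

(** * Triangles *)

Section Triangle.

Variables (N : finType) (zero idn succ inp : N).

(* Row [i] of a triangle has the cells [L i k] for [k < i].  A row with a cell
   containing [idn] is a record of the values at [k] of all functions: [idn]
   lies in the cell [k] and [a] in the cell [f a k]. *)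
Definition tri_holds (L : nat -> nat -> {set N}) (c : constraint N) : Prop :=
  match c with
  | Comp a b c => forall i i' z u, i < i' -> z < i -> u < i ->
      b \in L i z -> c \in L i u -> idn \in L i' z -> a \in L i' u
  | Cond z p e a b => forall i u, u < i -> zero \in L i 0 -> (p \in L i 0) = z ->
      if e then (a \in L i u) = (b \in L i u) else ~~ ((a \in L i u) && (b \in L i u))
  end.

(** A row without [idn] records nothing; such rows must be allowed, since row [i] is too short for a
    record with a value at least [i]. The last clause makes records recur, which compensates for
    [Comp] comparing a row with later rows only. *)
Definition triangle cs x (L : nat -> nat -> {set N}) : Prop :=
  (forall i a u u', u < u' -> u' < i -> a \in L i u -> a \notin L i u') /\
  (forall i k a, k < i -> idn \in L i k -> exists2 u, u < i & a \in L i u) /\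
  (forall i k, k < i -> zero \in L i k -> k = 0) /\
  (forall i k, k < i -> idn \in L i k -> k.+1 < i /\ succ \in L i k.+1) /\
  (forall i k, k < i -> inp \in L i k -> k = x) /\
  (forall c, List.In c cs -> tri_holds L c) /\
  (forall i k, k < i -> exists2 i', i < i' & idn \in L i' k).

(** The added equations [f a (f idn k) = f a k] are trivial for functions; on a triangle they say
    that two records of the same [k] agree. *)
Definition consistent (cs : seq (constraint N)) :=
  cs ++ [seq Comp a idn a | a <- enum N].

Lemma solves_triangle cs x f : solves zero idn succ inp cs x f ->
  exists L, triangle (consistent cs) x L.
Proof.
move=> [h0 h1 h2 h3 /holds_all_In h4].
have {}h4 c : List.In c (consistent cs) -> holds f c.
  move=> /In_cat[/h4//|/In_map[a _ ->] k].
  by rewrite h1.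
(* [code_hd] takes every value infinitely often: row [i] is reserved for the argument [code_hd i],
   and stays empty when some value does not fit. *)
pose kap := code_hd.
pose L i u := [set a | [forall b, f b (kap i) < i] && (f a (kap i) == u)].
have LE i u a : a \in L i u -> f a (kap i) = u /\ forall b, f b (kap i) < i.
  by rewrite inE => /andP[/forallP ? /eqP].
have LI i u a : (forall b, f b (kap i) < i) -> (a \in L i u) = (f a (kap i) == u).
  by move=> H; rewrite inE; have -> : [forall b, f b (kap i) < i] by apply/forallP.
exists L; split.
  move=> i a u u' uu' _ /LE[fu H]; rewrite LI // fu; apply/eqP => uu.
  by rewrite uu ltnn in uu'.
split; first by move=> i k a _ /LE[_ H]; exists (f a (kap i)); rewrite ?LI.
split; first by move=> i k _ /LE[<- _]; rewrite h0.
split.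
  move=> i k _ /LE[]; rewrite h1 => <- H; rewrite LI // h2 eqxx; split=> //.
  by have := H succ; rewrite h2.
split; first by move=> i k _ /LE[<- _]; rewrite h3.
split.
  move=> c /h4; case: c => [a b c|z p e a b] H /=.
    move=> i i' z u _ _ _ /LE[<- _] /LE[<- _] /LE[]; rewrite h1 => ki' H'.
    by rewrite LI // ki' H.
  move=> i u _ /LE[_ H']; rewrite !LI // => /H.
  case: e {H} => [/eqP->//|/negbT ab]; apply/negP => /andP[/eqP au /eqP bu].
  by rewrite au bu eqxx in ab.
(* [code_cons k M] has head [k] and exceeds [M], hence exceeds [i] and all values [f b k]. *)
move=> i k _; pose M := i + \sum_b f b k; exists (code_cons k M).
  rewrite /code_cons; apply: (@leq_trans M.+1); first by rewrite ltnS leq_addr.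
  by apply: leq_trans (leq_pmull _ _); rewrite ?expn_gt0 // ltnS -addnn leq_addr.
rewrite LI; first by rewrite h1 /kap code_consK1.
move=> b; rewrite /kap code_consK1 /code_cons; apply: (@leq_trans M.+1).
  by rewrite ltnS /M (bigD1 b) //= addnCA leq_addr.
by apply: leq_trans (leq_pmull _ _); rewrite ?expn_gt0 // ltnS -addnn leq_addr.
Qed.

Lemma triangle_solves cs x L : triangle (consistent cs) x L ->
  exists f, solves zero idn succ inp cs x f.
Proof.
move=> [t1 [t2 [t3 [t4 [t5 [t6 t7]]]]]].
have uniqL i a u u' : u < i -> u' < i -> a \in L i u -> a \in L i u' -> u = u'.
  move=> ui ui' au au'; case: (ltngtP u u') => // uu'.
    by have := t1 i a _ _ uu' ui' au; rewrite au'.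
  by have := t1 i a _ _ uu' ui au'; rewrite au.
(* The value of [a] at [k] is read off any record of [k]: recurrence gives a record, and the
   constraints [Comp a idn a] make the choice of the row irrelevant. *)
pose rec a k u := exists i, [/\ k < i, u < i, idn \in L i k & a \in L i u].
have recE a k : exists u, rec a k u.
  have [i ki hi] := t7 k.+1 k (ltnSn _); have ki' := ltnW ki.
  by have [u ui au] := t2 i k a ki' hi; exists u, i.
have cons a i i' k u : i < i' -> k < i -> u < i ->
    idn \in L i k -> a \in L i u -> idn \in L i' k -> a \in L i' u.
  apply: (t6 (Comp a idn a)); apply/In_cat; right; apply/In_map; exists a => //.
  by apply/In_mem; rewrite mem_enum.
have recU a k u u' : rec a k u -> rec a k u' -> u = u'.
  move=> [i [ki ui hi au]] [i' [ki' ui' hi' au']].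
  case: (ltngtP i i') => ii'.
  - exact: (uniqL i' a u u' (ltn_trans ui ii') ui' (cons _ _ _ _ _ ii' ki ui hi au hi') au').
  - exact: (uniqL i a u u' ui (ltn_trans ui' ii') au (cons _ _ _ _ _ ii' ki' ui' hi' au' hi)).
  - by subst i'; exact: (uniqL i a).
pose f a k := wit (rec a k).
have fP a k : rec a k (f a k) by apply: witP; exact: recE.
have fE a k i u : k < i -> u < i -> idn \in L i k -> a \in L i u -> f a k = u.
  by move=> ki ui hi au; apply: (recU a k) (fP a k) _; exists i.
have row k : exists i, [/\ k < i, idn \in L i k & forall a, f a k < i /\ a \in L i (f a k)].
  have [i ki hi] := t7 k.+1 k (ltnSn _); have ki' := ltnW ki; exists i; split=> // a.
  by have [u ui au] := t2 i k a ki' hi; rewrite (fE a k i u).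
have idE k : f idn k = k by have [i [ki hi _]] := row k; exact: (fE _ _ i).
have zeroE k : f zero k = 0.
  by have [i [ki hi /(_ zero)[]]] := row k; exact: t3.
exists f; split=> //.
- by move=> k; have [i [ki hi _]] := row k; have [? ?] := t4 _ _ ki hi; exact: (fE _ _ i).
- by move=> k; have [i [ki hi /(_ inp)[]]] := row k; exact: t5.
apply/holds_all_In => c cc.
have {}cc : List.In c (consistent cs) by apply/In_cat; left.
case: c cc => [a b c|z p e a b] cc k.
  have [i [ki hi fi]] := row k; have [bi hb] := fi b; have [ci hc] := fi c.
  (* Recurrence supplies a record of [f b k] after the record of [k], the only order in which [Comp]
     speaks. *)
  have [i' ii' hi'] := t7 i _ bi.
  apply: (fE _ _ i') => //; try exact: ltn_trans ii'.
  exact: (t6 _ cc i i' _ _ ii' bi ci hb hc hi').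
have [i [ki hi fi]] := row k.
have inE q u : u < i -> (q \in L i u) = (f q k == u).
  move=> ui; have [qi hq] := fi q; apply/idP/eqP => [qu|<-//].
  exact: (uniqL i q).
have i0 : 0 < i by apply: leq_ltn_trans ki.
have z0 : zero \in L i 0 by rewrite inE // zeroE.
move=> pz; have [ai ha] := fi a; have := t6 _ cc i (f a k) ai z0.
rewrite !inE // pz => /(_ erefl); rewrite eqxx /= eq_sym.
by case: e {cc} => [<-|/negbTE].
Qed.

End Triangle.

(** * Chain automata *)

Lemma In_flatten_map (T U : Type) (h : T -> seq U) y s :
  List.In y (flatten (map h s)) <-> exists2 x, List.In x s & List.In y (h x).
Proof.
elim: s => [|x s IHs] /=; first by split=> // -[].
rewrite In_cat IHs; split=> [[yx|[z zs yz]]|[z [->|zs] yz]].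
- by exists x; auto.
- by exists z; auto.
- by left.
- by right; exists z.
Qed.

Section EventTimes.

Variables (R : realType) (T : Type) (w : nat -> R * T).

Definition time_before (i : nat) : R := (\sum_(j < i) (w j).1)%R.
Definition event_time (i : nat) : R := time_before i.+1.

Lemma event_timeE i : event_time i = (time_before i + (w i).1)%R.
Proof. by rewrite /event_time /time_before big_ord_recr. Qed.

Lemma time_before0 : time_before 0 = 0%R.
Proof. by rewrite /time_before big_ord0. Qed.

End EventTimes.

Definition word_of (R : realType) (T : Type) (t : nat -> R) (a : nat -> T) (i : nat) : R * T :=
  ((t i - (if i is j.+1 then t j else 0))%R, a i).

Lemma event_time_word_of (R : realType) (T : Type) (t : nat -> R) (a : nat -> T) :
  event_time (word_of t a) = t.
Proof.
apply/funext; elim=> [|i IHi].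
  by rewrite event_timeE time_before0 /= subr0 add0r.
by rewrite event_timeE -/(event_time _ i) IHi /= addrC subrK.
Qed.

Section Chains.

Variables (Sg : finType) (n : nat).
Let clocks := 'I_n.+2.

Definition clock0 : clocks := ord0.
Definition clock1 : clocks := lift ord0 ord0.

(* [None] stands for the only guard depending on the input [x] (see [edge_guard]). *)
Record edge := Edge {
  edge_letter : pred Sg;
  edge_test : option (guard n.+2);
  edge_resets : {set 'I_n.+2}
}.

Definition edge_guard (x : nat) (e : edge) : guard n.+2 :=
  if edge_test e is Some g then g else GNot (GCmp clock1 CEq x.+1).

(* A linear automaton: at each position it may follow self-loops, or move on to
   the next position; it accepts by reaching and never leaving the last one. *)
Record chain := Chain {
  chain_steps : seq (seq edge * edge);
  chain_final : seq edge
}.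

Definition chain_out (c : chain) (s : nat) : seq (edge * nat) :=
  if s < size (chain_steps c) then
    let: (ls, e) := nth ([::], Edge pred0 None finset.set0) (chain_steps c) s in
    [seq (l, s) | l <- ls] ++ [:: (e, s.+1)]
  else if s == size (chain_steps c) then [seq (l, s) | l <- chain_final c] else [::].

Section ChainSemantics.

Variables (R : realType) (x : nat).
(* Event [i] has absolute time [T i] and letter [a i]; [r y] is the time of the
   last reset of the clock [y]. *)
Variables (T : nat -> R) (a : nat -> Sg).
Implicit Types (r : clocks -> R) (e : edge).

Definition edge_ok e i r : bool :=
  edge_letter e (a i) && guard_sat (fun y => (T i - r y)%R) (edge_guard x e).

Definition edge_upd e i r : clocks -> R :=
  fun y => if y \in edge_resets e then T i else r y.

Inductive loops (ls : seq edge) : nat -> (clocks -> R) -> nat -> (clocks -> R) -> Prop :=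
| loops_nil i r : loops ls i r i r
| loops_cons i r e j r' : List.In e ls -> edge_ok e i r ->
    loops ls i.+1 (edge_upd e i r) j r' -> loops ls i r j r'.

Definition stays (ls : seq edge) i r : Prop :=
  exists2 rs : nat -> clocks -> R, rs 0 = r &
    forall j, exists e, [/\ List.In e ls, edge_ok e (i + j) (rs j)
                          & rs j.+1 = edge_upd e (i + j) (rs j)].

(** Recursion on the remaining steps, so that acceptance by a concrete chain unfolds into nested
    existentials over event indices. *)
Fixpoint chain_acc (st : seq (seq edge * edge)) (fin : seq edge) i r : Prop :=
  if st is (ls, e) :: st' then
    exists j r', [/\ loops ls i r j r', edge_ok e j r'
                   & chain_acc st' fin j.+1 (edge_upd e j r')]
  else stays fin i r.

Arguments chain_acc : simpl never.

Definition accepts (c : chain) i r := chain_acc (chain_steps c) (chain_final c) i r.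

Definition chain_step c i s r s' r' : Prop :=
  exists e, [/\ List.In (e, s') (chain_out c s), edge_ok e i r & r' = edge_upd e i r].

Lemma chain_outE c s e s' : List.In (e, s') (chain_out c s) <->
  (exists ls f st, drop s (chain_steps c) = (ls, f) :: st /\
     (s' = s /\ List.In e ls \/ s' = s.+1 /\ e = f)) \/
  (s = size (chain_steps c) /\ s' = s /\ List.In e (chain_final c)).
Proof.
rewrite /chain_out; case: (ltngtP s (size (chain_steps c))) => sc.
- rewrite (drop_nth ([::], Edge pred0 None finset.set0) sc).
  case: nth => ls f; rewrite In_cat In_map /=.
  split=> [[[l lls [-> ->]]|[[<- <-]|//]]|[[ls' [f' [st [[-> -> _] [[-> els]|[-> ->]]]]]]|[sE]]].
  + by left; exists ls, f, (drop s.+1 (chain_steps c)); auto.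
  + by left; exists ls, f, (drop s.+1 (chain_steps c)); auto.
  + by left; exists e.
  + by right; left.
  + by rewrite sE ltnn in sc.
- split=> // -[[ls [f [st []]]]|[sE]]; first by rewrite drop_oversize // ltnW.
  by rewrite sE ltnn in sc.
- rewrite In_map; split=> [[l lls [-> ->]]|]; first by right.
  move=> [[ls [f [st []]]]|[_ [-> ef]]]; first by rewrite sc drop_size.
  by exists e.
Qed.

(** The last position offers nothing but loops, so a run that reaches it stays there; the induction
    is on the number of events up to that moment. *)
Lemma chain_acc_run c i s r (ss : nat -> nat) (rs : nat -> clocks -> R) :
  (forall j, chain_step c j (ss j) (rs j) (ss j.+1) (rs j.+1)) ->
  (exists2 j, i <= j & ss j = size (chain_steps c)) ->
  ss i = s -> rs i = r -> chain_acc (drop s (chain_steps c)) (chain_final c) i r.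
Proof.
move=> step [j ij sj]; move: s r; rewrite -(subnKC ij) in sj.
have stay j' m : ss j' = size (chain_steps c) -> ss (j' + m) = size (chain_steps c).
  move=> sj'; elim: m => [|m IHm]; rewrite ?addn0 ?addnS //.
  have [e [/chain_outE[[ls [f [st [dE _]]]]|[_ [-> _]//]] _ _]] := step (j' + m).
  by move: dE; rewrite IHm drop_size.
move: (j - i) sj => l sj {ij}; elim: l i sj => [|m IHm] i sj s r sE rE.
  rewrite addn0 sE in sj; rewrite sj drop_size.
  exists (fun j => rs (i + j)); rewrite ?addn0 // => j'; rewrite addnS.
  have [e [/chain_outE[[ls [f [st [dE _]]]]|[_ [_ ef]]] ok upd]] := step (i + j').
    by move: dE; rewrite stay ?sE // drop_size.
  by exists e.
have [e [/chain_outE] ] := step i; rewrite sE rE => eo ok upd.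
rewrite -addSnnS in sj.
case: eo => [[ls [f [st [dE]]]]|[sc [s'E ef]]]; last first.
  rewrite sc drop_size; exists (fun j => rs (i + j)); rewrite ?addn0 // => j'.
  rewrite addnS.
  have [e' [/chain_outE[[ls [f [st [dE _]]]]|[_ [_ ef']]] ok' upd']] := step (i + j').
    by move: dE; rewrite stay ?sE // drop_size.
  by exists e'.
case=> [[s'E els]|[s'E eE]].
  have := IHm _ sj _ _ s'E upd; rewrite dE => -[j' [r' [lp ok' acc]]].
  by exists j', r'; split=> //; exact: loops_cons lp.
have := IHm _ sj _ _ s'E upd; rewrite -addn1 addnC -drop_drop dE /= drop0 => acc.
by exists i, r; split; rewrite -?eE //; exact: loops_nil.
Qed.

Definition chain_run c i s r : Prop :=
  exists (ss : nat -> nat) (rs : nat -> clocks -> R),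
    [/\ ss 0 = s, rs 0 = r,
        forall j, chain_step c (i + j) (ss j) (rs j) (ss j.+1) (rs j.+1)
      & exists m, forall j, m <= j -> ss j = size (chain_steps c)].

Lemma chain_run_cons c i s r s' r' :
  chain_step c i s r s' r' -> chain_run c i.+1 s' r' -> chain_run c i s r.
Proof.
move=> st [ss [rs [s0 r0 sts [m sm]]]].
exists (fun j => if j is j'.+1 then ss j' else s), (fun j => if j is j'.+1 then rs j' else r).
split=> //; last by exists m.+1 => -[].
by case=> [|j]; rewrite ?addn0 ?s0 ?r0 // addnS -addSn.
Qed.

Lemma chain_run_loops c s ls f st i r j r' :
  drop s (chain_steps c) = (ls, f) :: st ->
  loops ls i r j r' -> chain_run c j s r' -> chain_run c i s r.
Proof.
move=> dE; elim=> // {}i {}r e {}j {}r' els ok lp IH /IH; apply: chain_run_cons.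
by exists e; split=> //; apply/chain_outE; left; exists ls, f, st; split=> //; left.
Qed.

Lemma chain_acc_chain_run c s i r : s <= size (chain_steps c) ->
  chain_acc (drop s (chain_steps c)) (chain_final c) i r -> chain_run c i s r.
Proof.
move=> sle; move dE: (drop s _) => st.
elim: st s sle dE i r => [|[ls f] st IHst] s sle dE i r.
  move=> [rs r0 H]; have sE : s = size (chain_steps c).
    by apply/eqP; rewrite eqn_leq sle -subn_eq0 -size_drop dE.
  exists (fun=> s), rs; split=> //; last by exists 0.
  move=> j; have [e [ef ok upd]] := H j; exists e; split=> //.
  by apply/chain_outE; right.
have slt : s < size (chain_steps c).
  by rewrite ltnNge; apply/negP => /drop_oversize; rewrite dE.
move=> [j [r' [lp ok acc]]]; apply: (chain_run_loops dE lp).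
apply: (@chain_run_cons _ _ _ _ s.+1 (edge_upd f j r')).
  by exists f; split=> //; apply/chain_outE; left; exists ls, f, st; auto.
by apply: IHst => //; rewrite -addn1 addnC -drop_drop dE /= drop0.
Qed.

End ChainSemantics.

(** * The automaton of a finite list of chains *)

Variable cs : seq chain.

Definition max_pos := \max_(c <- cs) size (chain_steps c).
(** A disjoint union of chains: the first component is constant along a run, and positions beyond
    the end of a short chain have no outgoing edge. *)
Definition cstate : finType := ('I_(size cs) * 'I_max_pos.+1)%type.
Definition chain_of (q : cstate) : chain := nth (Chain [::] [::]) cs q.1.

Definition state_out (q : cstate) : seq (edge * cstate) :=
  [seq (d.1, (q.1, inord d.2) : cstate) | d <- chain_out (chain_of q) q.2].

(** This list does not mention [x]; only [mk_transition] inserts it, which makes the code of the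
    automaton recursive in [x]. *)
Definition chain_transitions : seq (cstate * Sg * (edge * cstate)) :=
  flatten [seq flatten [seq [seq (q, s, d) | s <- enum Sg & edge_letter d.1 s]
                       | d <- state_out q] | q <- enum {: cstate}].

Definition mk_transition (x : nat) (d : cstate * Sg * (edge * cstate)) :
    transition #|Sg| n.+2 #|cstate| :=
  Transition (enum_rank d.1.1) (enum_rank d.1.2) (edge_guard x d.2.1)
    (edge_resets d.2.1) (enum_rank d.2.2).

Definition chain_tba (x : nat) : tba #|Sg| n.+2 :=
  @TBA #|Sg| n.+2 #|cstate| [set q | (enum_val q).2 == ord0]
    [set q | val (enum_val q).2 == size (chain_steps (chain_of (enum_val q)))]
    [seq mk_transition x d | d <- chain_transitions].

Lemma chain_transitionsE q s d : List.In (q, s, d) chain_transitions <->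
  List.In d (state_out q) /\ edge_letter d.1 s.
Proof.
rewrite In_flatten_map; split=> [[q' _]|[dq ds]].
  rewrite In_flatten_map => -[d' d'q'] /In_map[s' /In_mem].
  by rewrite mem_filter => /andP[? _] [-> -> ->].
exists q; first by apply/In_mem; rewrite mem_enum.
apply/In_flatten_map; exists d => //; apply/In_map; exists s => //.
by apply/In_mem; rewrite mem_filter ds mem_enum.
Qed.

Section Language.

Variables (R : realType) (x : nat) (w : nat -> R * 'I_#|Sg|).

Definition event_letter (i : nat) : Sg := enum_val (w i).2.

Let time_before := time_before w.
Let event_time := event_time w.

Lemma size_chain_le c : List.In c cs -> size (chain_steps c) <= max_pos.
Proof.
rewrite /max_pos; elim: cs => //= c' s IH [->|/IH H]; rewrite big_cons leq_max ?leqnn //.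
by rewrite H orbT.
Qed.

Lemma chain_of_In q : List.In (chain_of q) cs.
Proof.
rewrite /chain_of; case: q => -[j jlt] p /= {p}.
by elim: cs j jlt => //= c s IH [|j] jlt; [left|right; apply: IH].
Qed.

Lemma chain_out_le c s e s' : List.In (e, s') (chain_out c s) ->
  s' <= size (chain_steps c).
Proof.
move/chain_outE => [[ls [f [st [dE H]]]]|[-> [-> _]]//].
have slt : s < size (chain_steps c).
  by rewrite ltnNge; apply/negP => /drop_oversize; rewrite dE.
by case: H => [[-> _]|[-> _]] //; exact: ltnW.
Qed.

(** A valuation and the times of the last resets determine each other, a clock showing the current
    time minus its last reset time. *)
Lemma chain_tba_step (q q' : cstate) i (r r' : clocks -> R) :
  step (A := chain_tba x) (enum_rank q) (fun y => time_before i - r y)%R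
    (w i).1 (w i).2 (enum_rank q') (fun y => time_before i.+1 - r' y)%R <->
  q'.1 = q.1 /\ chain_step x event_time event_letter (chain_of q) i q.2 r q'.2 r'.
Proof.
have dE s : delay (fun y => time_before i - s y)%R (w i).1 =
    (fun y : clocks => event_time i - s y)%R.
  by apply/funext => y; rewrite /delay /event_time event_timeE addrAC.
rewrite /step /chain_step; split.
  case=> t [/= /In_map[[[q1 s] [e q2]] /chain_transitionsE[/In_map[[e' s'] /= out]]]].
  move=> [-> ->] es -> /= [/enum_rank_inj q1E /enum_rank_inj q2E] sE; rewrite dE => ok upd.
  rewrite -{}q2E -{}q1E /=; split=> //; exists e'; split.
  - rewrite inordK // ltnS (leq_trans (chain_out_le out)) //.
    exact/size_chain_le/chain_of_In.
  - by rewrite /edge_ok /event_letter -sE enum_rankK es.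
  - apply/funext => y; move/(congr1 (fun f => f y)): upd; rewrite /reset /edge_upd.
    rewrite -/(event_time i); case: ifP => _; first by move/subr0_eq.
    by move/addrI/oppr_inj.
case=> q1 [e [out /andP[es ok] ->]].
exists (mk_transition x (q, event_letter i, (e, q'))); split=> //=.
- apply/In_map; exists (q, event_letter i, (e, q')) => //; apply/chain_transitionsE.
  split=> //; apply/In_map; exists (e, val q'.2) => //=; congr pair.
  by rewrite inord_val -q1; case: (q').
- by rewrite /event_letter enum_valK.
- by rewrite dE.
- rewrite dE; apply/funext => y; rewrite /reset /edge_upd -/(event_time i).
  by case: ifP => _ //; rewrite subrr.
Qed.

Lemma chain_tba_language :
  L_omega R (chain_tba x) w <->
  timed_word w /\
  exists2 c, List.In c cs & accepts x event_time event_letter c 0 (fun=> 0%R).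
Proof.
split=> [[tw [q [v [[q0 v0 st] inf]]]]|[tw [c cc acc]]]; split=> //.
  pose qs i : cstate := enum_val (q i).
  pose rs i : clocks -> R := fun y => (time_before i - v i y)%R.
  have vE i : v i = (fun y => time_before i - rs i y)%R.
    by apply/funext => y; rewrite /rs subKr.
  have {}st i : (qs i.+1).1 = (qs i).1 /\
      chain_step x event_time event_letter (chain_of (qs i)) i (qs i).2 (rs i)
        (qs i.+1).2 (rs i.+1).
    by apply/chain_tba_step; rewrite /qs !enum_valK -!vE.
  have q1 i : (qs i).1 = (qs 0).1 by elim: i => // i <-; exact: (st i).1.
  exists (chain_of (qs 0)); first exact: chain_of_In.
  rewrite /accepts -[chain_steps _]drop0.
  apply: (@chain_acc_run _ _ _ _ _ 0 0 _ (fun i => (qs i).2) rs).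
  - by move=> j; have [_] := st j; rewrite /chain_of q1.
  - have [j _] := inf 0; rewrite inE => /eqP jE; exists j => //.
    by rewrite jE /chain_of -/(qs j) q1.
  - by move: q0; rewrite inE => /eqP/(congr1 val).
  - by apply/funext => y; rewrite /rs v0 /time_before time_before0 subrr.
have [k klt kE] : exists2 k, k < size cs & nth (Chain [::] [::]) cs k = c.
  elim: cs cc => //= c' s IH [->|/IH[k klt kE]]; [by exists 0|by exists k.+1].
have [ss [rs [s0 r0 st [m sm]]]] := @chain_acc_chain_run _ _ _ _ c 0 0 _ (leq0n _)
  (eq_ind_r (fun s => chain_acc _ _ _ s _ _ _) acc (drop0 _)).
have sle i : ss i <= max_pos.
  apply: leq_trans (size_chain_le cc); case: i => [|i]; first by rewrite s0.
  by have [e [/chain_out_le]] := st i.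
pose qs i : cstate := (Ordinal klt, inord (ss i)).
exists (fun i => enum_rank (qs i)), (fun i y => time_before i - rs i y)%R; split.
  split.
  - by rewrite inE enum_rankK /= s0; apply/eqP/val_inj; rewrite /= inordK.
  - by apply/funext => y; rewrite r0 /time_before time_before0 subrr.
  - move=> i; apply/chain_tba_step; split=> //.
    by rewrite /chain_of /= kE !inordK ?ltnS //; have := st i; rewrite add0n.
move=> j; exists (maxn j m); first exact: leq_maxl.
by rewrite inE enum_rankK /chain_of /= kE inordK ?ltnS // sm // leq_maxr.
Qed.

End Language.

Lemma recursive1_code_transition d :
  recursive1 (fun x => code_transition (mk_transition x d)).
Proof.
apply: (@recursive1_code_nth [:: fun=> enum_rank d.1.1 : nat; fun=> enum_rank d.1.2 : nat;
  fun x => code_guard (edge_guard x d.2.1); fun=> code_set (edge_resets d.2.1);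
  fun=> enum_rank d.2.2 : nat]).
case=> [|[|[|[|[|i]]]]]; try exact: recursive1_const.
  rewrite [nth _ _ _]/= /edge_guard; case: (edge_test _) => [g|]; first exact: recursive1_const.
  apply: (@recursive1_code_nth [:: fun=> 2; fun x => code_guard (GCmp clock1 CEq x.+1)]).
  case=> [|[|i]]; [exact: recursive1_const| |by rewrite /= nth_nil; exact: recursive1_const].
  apply: (@recursive1_code_nth [:: fun=> 1; fun=> _; fun=> _; succn]).
  case=> [|[|[|[|i]]]]; [exact: recursive1_const|exact: recursive1_const|
    exact: recursive1_const|exact: recursive1_succ|].
  by rewrite /= nth_nil; exact: recursive1_const.
by rewrite /= nth_nil; exact: recursive1_const.
Qed.

Lemma recursive1_code_chain_tba : recursive1 (fun x => code_tba (chain_tba x)).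
Proof.
apply: (@recursive1_code_nth [:: fun=> _; fun=> _; fun=> _; fun=> _; fun=> _;
  fun x => CodeSeq.code [seq code_transition e | e <- trans (chain_tba x)]]).
case=> [|[|[|[|[|[|i]]]]]].
- exact: recursive1_const.
- exact: recursive1_const.
- exact: (recursive1_const #|cstate|).
- exact: (recursive1_const (code_set (initial (chain_tba 0)))).
- exact: (recursive1_const (code_set (accepting (chain_tba 0)))).
- rewrite [nth _ _ _]/=; have -> : (fun x => CodeSeq.code [seq code_transition e | e <- trans (chain_tba x)]) =
    fun x => CodeSeq.code [seq code_transition (mk_transition x d) | d <- chain_transitions].
    by apply/funext => x /=; rewrite -map_comp.
  apply: recursive1_code => d; exact: recursive1_code_transition.
- by rewrite /= nth_nil; exact: recursive1_const.
Qed.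
End Chains.

Arguments chain_acc : simpl never.

(** * Elementary chains *)

Section ElementaryChains.

Variables (Sg : finType) (n : nat) (R : realType) (x : nat).
Variables (T : nat -> R) (a : nat -> Sg).
Implicit Types (P Q : pred Sg) (r : 'I_n.+2 -> R) (e : edge Sg n).

Local Notation acc := (chain_acc x T a).

Definition skip P : edge Sg n := Edge P (Some GTrue) finset.set0.
Definition start P (y : 'I_n.+2) : edge Sg n := Edge P (Some GTrue) [set y].
Definition test P g : edge Sg n := Edge P (Some g) finset.set0.

Lemma edge_upd0 P o i r : edge_upd T (Edge P o finset.set0) i r = r.
Proof. by apply/funext => y; rewrite /edge_upd /= finset.in_set0. Qed.

Lemma skip_ok P i r : edge_ok x T a (skip P) i r = P (a i).
Proof. by rewrite /edge_ok /= andbT. Qed.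

Lemma loops_trans (ls : seq (edge Sg n)) i r j r' k r'' :
  loops x T a ls i r j r' -> loops x T a ls j r' k r'' -> loops x T a ls i r k r''.
Proof.
by elim=> // {}i {}r e {}j {}r' els ok lp IH /IH; exact: loops_cons.
Qed.

Lemma loops_skipI (ls : seq (edge Sg n)) P i j r : List.In (skip P) ls -> i <= j ->
  (forall m, i <= m < j -> P (a m)) -> loops x T a ls i r j r.
Proof.
move=> inls ij; rewrite -(subnKC ij); move: (j - i) => l {ij}.
elim: l i => [|m IHm] i H.
  by rewrite addn0; exact: loops_nil.
apply: (loops_cons inls); first by rewrite skip_ok H // leqnn addnS ltnS leq_addr.
rewrite edge_upd0 addnS -addSn; apply: IHm => k /andP[ik km].
by apply: H; rewrite (ltnW ik) addnS -addSn.
Qed.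

Lemma loops_skipE P i j r r' : loops x T a [:: skip P] i r j r' ->
  [/\ i <= j, r' = r & forall m, i <= m < j -> P (a m)].
Proof.
elim=> [{}i {}r|{}i {}r e {}j {}r' [<-|//]].
  by split=> // m /andP[im mi]; rewrite leqNgt mi in im.
rewrite skip_ok edge_upd0 => Pi _ [ij -> H]; split=> //; first exact: ltnW.
move=> m /andP[]; rewrite leq_eqVlt => /orP[/eqP<-//|im mj].
by apply: H; rewrite im.
Qed.

Lemma acc_skipE P e st fin i r : acc (([:: skip P], e) :: st) fin i r ->
  exists j, [/\ i <= j, forall m, i <= m < j -> P (a m), edge_ok x T a e j r
              & acc st fin j.+1 (edge_upd T e j r)].
Proof. by move=> [j [r' [/loops_skipE[ij -> H] ok ac]]]; exists j. Qed.

Lemma acc_skipI P e st fin i j r : i <= j -> (forall m, i <= m < j -> P (a m)) ->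
  edge_ok x T a e j r -> acc st fin j.+1 (edge_upd T e j r) ->
  acc (([:: skip P], e) :: st) fin i r.
Proof.
move=> ij H ok ac; exists j, r; split=> //.
by apply: (loops_skipI (P := P)) => //; left.
Qed.

Lemma acc_loopsE (ls : seq (edge Sg n)) e st fin i r : acc ((ls, e) :: st) fin i r ->
  exists j r', [/\ loops x T a ls i r j r', edge_ok x T a e j r'
                 & acc st fin j.+1 (edge_upd T e j r')].
Proof. by []. Qed.

Lemma acc_loopsI (ls : seq (edge Sg n)) e st fin i r j r' :
  loops x T a ls i r j r' -> edge_ok x T a e j r' ->
  acc st fin j.+1 (edge_upd T e j r') -> acc ((ls, e) :: st) fin i r.
Proof. by move=> lp ok ac; exists j, r'. Qed.

Lemma acc_sink i r : acc [::] [:: skip predT] i r.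
Proof.
by exists (fun=> r) => // j; exists (skip predT); rewrite skip_ok edge_upd0; split=> //; left.
Qed.

Definition untimed P1 N1 P2 N2 P3 : chain Sg n :=
  Chain [:: ([:: skip predT], skip P1); ([:: skip N1], skip P2); ([:: skip N2], skip P3)]
    [:: skip predT].

Lemma untimedP P1 N1 P2 N2 P3 r : accepts x T a (untimed P1 N1 P2 N2 P3) 0 r <->
  exists i j k, [/\ i < j < k, P1 (a i), P2 (a j) & P3 (a k)] /\
    (forall m, i < m < j -> N1 (a m)) /\ (forall m, j < m < k -> N2 (a m)).
Proof.
split.
  rewrite /accepts /=; case/acc_skipE => i [_ _]; rewrite skip_ok => Pi /acc_skipE[j [ij Nj]].
  rewrite skip_ok => Pj /acc_skipE[k [jk Nk]]; rewrite skip_ok => Pk _.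
  by exists i, j, k; rewrite ij jk.
move=> [i [j [k [[/andP[ij jk] Pi Pj Pk] [Nj Nk]]]]].
rewrite /accepts /=; apply: (acc_skipI (j := i)); rewrite ?skip_ok //.
apply: (acc_skipI (j := j)); rewrite ?skip_ok //.
by apply: (acc_skipI (j := k)); rewrite ?skip_ok //; exact: acc_sink.
Qed.

Definition untimed2 P1 N1 P2 := untimed P1 N1 P2 predT predT.

Lemma untimed2P P1 N1 P2 r : accepts x T a (untimed2 P1 N1 P2) 0 r <->
  exists i j, [/\ i < j, P1 (a i), P2 (a j) & forall m, i < m < j -> N1 (a m)].
Proof.
rewrite untimedP; split=> [[i [j [k [[/andP[ij _] Pi Pj _] [N _]]]]]|[i [j [ij Pi Pj N]]]].
  by exists i, j.
by exists i, j, j.+1; rewrite ij ltnSn.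
Qed.

Definition timed_pair P1 g P2 : chain Sg n :=
  Chain [:: ([:: skip predT], start P1 (clock0 n)); ([:: skip predT], test P2 g)]
    [:: skip predT].

Lemma timed_pairP P1 op c P2 r :
  accepts x T a (timed_pair P1 (GCmp (clock0 n) op c) P2) 0 r <->
  exists i j, [/\ i < j, P1 (a i), P2 (a j) & cmp_sat (T j - T i)%R op c].
Proof.
split.
  rewrite /accepts /=; case/acc_skipE => i [_ _]; rewrite /edge_ok /= andbT => Pi /acc_skipE[j [ij _]].
  rewrite /edge_ok /edge_upd /= finset.in_set1 eqxx => /andP[Pj cj] _.
  by exists i, j.
move=> [i [j [ij Pi Pj cj]]].
rewrite /accepts /=; apply: (acc_skipI (j := i)); rewrite ?/edge_ok //= ?andbT //.
apply: (acc_skipI (j := j)) => //; last exact: acc_sink.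
by rewrite /edge_ok /edge_upd /= finset.in_set1 eqxx Pj.
Qed.

(** Detects an event without original: the instant one time unit before it falls strictly between
    two consecutive events. The loop on [pred0] forces the second reset at the very next event. *)
Definition gap P : chain Sg n :=
  Chain [:: ([:: skip predT], start predT (clock0 n)); ([:: skip pred0], start predT (clock1 n));
            ([:: skip predT], test P (GAnd (GCmp (clock0 n) CGt 1) (GCmp (clock1 n) CLt 1)))]
    [:: skip predT].

Lemma gapP P r : accepts x T a (gap P) 0 r <->
  exists i j, [/\ i.+1 < j, P (a j), (T j - T i > 1)%R & (T j - T i.+1 < 1)%R].
Proof.
split.
  rewrite /accepts /=; case/acc_skipE => i [_ _ _] /acc_skipE[i' [ii' H _]] /acc_skipE[j [ij _]].
  have {ii' H}E : i' = i.+1.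
    move: ii'; rewrite leq_eqVlt => /orP[/eqP->//|ii'].
    by have := H i.+1; rewrite leqnn ii' => /(_ isT).
  rewrite {i'}E in ij *.
  rewrite /edge_ok /edge_upd /= !finset.in_set1 /= => /and3P[Pj c0 c1] _.
  by exists i, j.
move=> [i [j [ij Pj c0 c1]]].
rewrite /accepts /=; apply: (acc_skipI (j := i)) => //.
apply: (acc_skipI (j := i.+1)) => //; first by move=> m; lia.
apply: (acc_skipI (j := j)) => //; last exact: acc_sink.
by rewrite /edge_ok /edge_upd /= !finset.in_set1 /= Pj c0.
Qed.

(** The absence of an event at distance one is a safety condition, expressed by staying in the last
    position for ever. *)
Definition no_copy : chain Sg n :=
  Chain [:: ([:: skip predT], start predT (clock0 n))]
    [:: test predT (GNot (GCmp (clock0 n) CEq 1))].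

Lemma no_copyP r : accepts x T a no_copy 0 r <->
  exists i, forall j, i < j -> T j <> (T i + 1)%R.
Proof.
split.
  rewrite /accepts /=; case/acc_skipE => i [_ _ _] /= [rs r0 H]; exists i => j ij.
  have rsE m : rs m = edge_upd T (start predT (clock0 n)) i r.
    elim: m => // m <-; have [e [[<-|//] _ ->]] := H m.
    by rewrite edge_upd0.
  have [e [[<-|//]]] := H (j - i.+1); rewrite subnKC // /edge_ok /= rsE.
  rewrite /edge_upd /= finset.in_set1 eqxx => /eqP Tj _ TE; apply: Tj.
  by rewrite TE addrC addKr.
move=> [i H]; rewrite /accepts /=; apply: (acc_skipI (j := i)) => //.
exists (fun=> edge_upd T (start predT (clock0 n)) i r) => // j.
exists (test predT (GNot (GCmp (clock0 n) CEq 1))); rewrite edge_upd0; split=> //; first by left.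
rewrite /edge_ok /edge_upd /= finset.in_set1 eqxx /=; apply/eqP => E.
by apply: (H (i.+1 + j)); [lia|lra].
Qed.

Definition first_letter P : chain Sg n := Chain [:: ([:: skip pred0], skip P)] [:: skip predT].
Definition second_letter P : chain Sg n :=
  Chain [:: ([:: skip pred0], skip predT); ([:: skip pred0], skip P)] [:: skip predT].
Definition first_time : chain Sg n :=
  Chain [:: ([:: skip pred0], test predT (GNot (GCmp (clock0 n) CEq 1)))] [:: skip predT].

Lemma skip_pred0 i j : i <= j -> (forall m, i <= m < j -> pred0 (a m)) -> j = i.
Proof.
rewrite leq_eqVlt => /orP[/eqP->//|ij] H.
by have := H i; rewrite leqnn ij => /(_ isT).
Qed.

Lemma no_skip P i m : i <= m < i -> P (a m).
Proof. by lia. Qed.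

Lemma first_letterP P r : accepts x T a (first_letter P) 0 r <-> P (a 0).
Proof.
rewrite /accepts /=; split=> [/acc_skipE[i [i0 /(skip_pred0 i0) -> ]]|P0]; first by rewrite skip_ok.
by apply: (acc_skipI (j := 0)); rewrite ?skip_ok //; exact: acc_sink.
Qed.

Lemma second_letterP P r : accepts x T a (second_letter P) 0 r <-> P (a 1).
Proof.
rewrite /accepts /=; split=> [/acc_skipE[i [i0 /(skip_pred0 i0) -> _]]|P1].
  by case/acc_skipE => j [j0 /(skip_pred0 j0) ->]; rewrite skip_ok.
apply: (acc_skipI (j := 0)); rewrite ?skip_ok //.
apply: (acc_skipI (j := 1)); rewrite ?skip_ok //; last exact: acc_sink.
exact: no_skip.
Qed.

Lemma first_timeP : accepts x T a first_time 0 (fun=> 0%R) <-> T 0 <> 1%R.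
Proof.
rewrite /accepts /=; split=> [/acc_skipE[i [i0 /(skip_pred0 i0) -> ]]|P0].
  by rewrite /edge_ok /= subr0 => /eqP.
apply: (acc_skipI (j := 0)) => //; last exact: acc_sink.
by rewrite /edge_ok /= subr0; apply/eqP.
Qed.

End ElementaryChains.

(** * Grids *)

Section Grid.

Variables (N : finType) (R : realType).

(* [None] opens a row, [Some None] creates a new column at the end of the row,
   and [Some (Some s)] is a cell of an older column. *)
Definition grid_letter : finType := option (option {set N}).

Definition is_open (l : grid_letter) : bool := l == None.
Definition is_new (l : grid_letter) : bool := l == Some None.
Definition is_cell (l : grid_letter) : bool := if l is Some (Some _) then true else false.
Definition has_bit (b : N) (l : grid_letter) : bool :=
  if l is Some (Some s) then b \in s else false.

(** Row [i] has [i.+2] events: its opening, the [i] older columns and the new one. *)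
Definition row_start (i : nat) : nat := \sum_(j < i) j.+2.

Lemma row_start0 : row_start 0 = 0. Proof. by rewrite /row_start big_ord0. Qed.
Lemma row_startS i : row_start i.+1 = row_start i + i.+2. Proof. by rewrite /row_start big_ord_recr. Qed.

Lemma row_lt i j p : p <= i.+1 -> i < j -> row_start i + p < row_start j.
Proof.
move=> pi; elim: j => // j IHj; rewrite ltnS leq_eqVlt row_startS => /orP[/eqP<-|/IHj]; lia.
Qed.

Lemma row_coord e : exists i p, p <= i.+1 /\ e = row_start i + p.
Proof.
elim: e => [|e [i [p [pi ->]]]]; first by exists 0, 0; rewrite row_start0.
move: pi; rewrite leq_eqVlt => /orP[/eqP->|pi]; last by exists i, p.+1; rewrite addnS.
by exists i.+1, 0; rewrite row_startS; split=> //; lia.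
Qed.

Variables (T : nat -> R) (a : nat -> grid_letter).
Hypothesis T_incr : forall i, (T i < T i.+1)%R.

Lemma T_lt i j : (T i < T j)%R = (i < j).
Proof. by have /leW_mono := (le_mono (homo_ltn lt_trans T_incr)); apply. Qed.

Lemma T_le i j : (T i <= T j)%R = (i <= j).
Proof. by rewrite !leNgt T_lt -leqNgt. Qed.

(** The clauses negate the chains of [structure_chains] in the same order, with two chains merged
    into the seventh clause. Together they say that each row is copied one time unit later, with one
    new column at its end. *)
Definition structured : Prop :=
  T 0 = 1%R /\ is_open (a 0) /\ is_new (a 1) /\
  (forall i, is_new (a i) -> is_open (a i.+1)) /\
  (forall i j, i < j -> is_open (a i) -> is_open (a j) ->
     exists2 m, i < m < j & is_open (a m) || is_new (a m)) /\
  (forall i, exists2 j, i < j & T j = (T i + 1)%R) /\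
  (forall i j, i < j -> T j = (T i + 1)%R ->
     if is_open (a i) then is_open (a j) else is_cell (a j)) /\
  (forall i j, i < j -> is_open (a i) -> is_open (a j) -> (1 <= T j - T i)%R) /\
  (forall i j, i.+1 < j -> is_cell (a j) -> (1 < T j - T i)%R -> (1 <= T j - T i.+1)%R).

Definition grid_at (L : nat -> nat -> {set N}) i p : grid_letter :=
  if p is k.+1 then if k == i then Some None else Some (Some (L i k)) else None.

(** Row [i] opens at time [i.+1] because the first event cannot occur at time 0. The column created
    in row [i] has number [i], hence position [i.+1]. *)
Definition grid (L : nat -> nat -> {set N}) (psi : nat -> R) : Prop :=
  [/\ psi 0 = 0%R, forall p, (psi p < psi p.+1)%R, forall p, (psi p < 1)%R
    & forall i p, p <= i.+1 ->
        T (row_start i + p) = (i.+1%:R + psi p)%R /\ a (row_start i + p) = grid_at L i p].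

Lemma letter_cases l : [|| is_open l, is_new l | is_cell l].
Proof. by case: l => [[s|]|]. Qed.

(** Induction on rows: the copies of the events of a row are consecutive in the next one, and
    exactly one new column follows them. *)
Lemma structured_grid : structured -> exists L psi, grid L psi.
Proof.
move=> [s1 [s2 [s3 [s4 [s5 [s6 [s7 [s8 s9]]]]]]]].
(* The fractional time of a column is read off the event that creates it. *)
pose psi p : R := if p is q.+1 then (T (row_start q + q.+1) - q.+1%:R)%R else 0%R.
have next_open i : is_open (a i) -> forall j, i < j -> is_open (a j) ->
    (T j <= T i + 1)%R -> T j = (T i + 1)%R.
  by move=> oi j ij oj Tj; have := s8 i j ij oi oj; lra.
have copy_open i : is_open (a i) -> exists2 j, i < j & T j = (T i + 1)%R /\ is_open (a j).
  by move=> oi; have [j ij Tj] := s6 i; exists j => //; have := s7 i j ij Tj; rewrite oi.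
have newN l : is_new l -> ~~ is_cell l && ~~ is_open l by case: l => [[]|].
have cellN l : is_cell l -> ~~ is_new l && ~~ is_open l by case: l => [[]|].
(* The opening of the next row belongs to the invariant, as the copies of row [i] are located from
   it. *)
have rows i : [/\ T (row_start i) = i.+1%:R%R /\ is_open (a (row_start i)),
    forall p, 0 < p <= i -> is_cell (a (row_start i + p)) /\ T (row_start i + p) = (i.+1%:R + psi p)%R,
    is_new (a (row_start i + i.+1)) &
    T (row_start i.+1) = i.+2%:R%R /\ is_open (a (row_start i.+1))].
  elim: i => [|i [[Tb ob] cells nw [Tb' ob']]].
    rewrite row_startS row_start0 !add0n; split=> //; first by move=> p; lia.
    have o2 := s4 _ s3; split=> //.
    have [j j0 [Tj oj]] := copy_open 0 s2.
    have j2 : 2 <= j.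
      suff : j != 1 by lia.
      by apply: contraTneq oj => ->; case/andP: (newN _ s3).
    have Tle : (T 2 <= T 0 + 1)%R by rewrite -Tj T_le.
    by rewrite (next_open 0 s2 2 isT o2 Tle) s1 -natr1.
  have bE : row_start i.+1 = (row_start i + i.+1).+1 by rewrite row_startS addnS.
  have copy p : p <= i.+1 -> T (row_start i.+1 + p) = (T (row_start i + p) + 1)%R /\
      (0 < p -> is_cell (a (row_start i.+1 + p))).
    elim: p => [_|p IHp pi].
      by rewrite !addn0 Tb' Tb -natr1; split.
    have {IHp}[Tp cp] := IHp (ltnW pi).
    have [j _ Tj] := s6 (row_start i + p.+1).
    have lt_j : row_start i + p.+1 < j by rewrite -T_lt Tj; lra.
    have nonopen : ~~ is_open (a (row_start i + p.+1)).
      move: pi; rewrite leq_eqVlt => /orP[/eqP->|pi]; first by case/andP: (newN _ nw).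
      by have [c _] := cells p.+1 pi; case/andP: (cellN _ c).
    have cj := s7 _ _ lt_j Tj; rewrite (negbTE nonopen) in cj.
    have jle : row_start i.+1 + p.+1 <= j.
      by rewrite addnS -T_lt Tp Tj ltrD2r T_lt addnS.
    have Tlt : (T j < T (row_start i.+1) + 1)%R by rewrite Tj ltrD2r T_lt bE; clear -pi; lia.
    (* An event before the copy [j] cannot be an opening, nor a new column with the opening that
       follows it, both being too close to the last opening; nor a cell, which would copy
       nothing. *)
    suff E : j = row_start i.+1 + p.+1 by rewrite -E; split.
    apply/eqP; rewrite eqn_leq jle andbT leqNgt; apply/negP => ej.
    have Tej : (T (row_start i.+1 + p.+1) < T j)%R by rewrite T_lt.
    have b_e : row_start i.+1 < row_start i.+1 + p.+1 by rewrite addnS ltnS leq_addr.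
    case/or3P: (letter_cases (a (row_start i.+1 + p.+1))) => ae.
    - by have := s8 _ _ b_e ob' ae; lra.
    - have oe := s4 _ ae; have := s8 _ _ (leqW b_e) ob' oe.
      have : (T (row_start i.+1 + p.+1).+1 <= T j)%R by rewrite T_le.
      by lra.
    - have lt1 : (row_start i + p).+1 < row_start i.+1 + p.+1 by rewrite bE; clear; lia.
      have := s9 _ _ lt1 ae; have : (T (row_start i.+1 + p) < T (row_start i.+1 + p.+1))%R.
        by rewrite T_lt ltn_add2l.
      by rewrite Tp -addnS; lra.
  have [j j0 [Tj oj]] := copy_open _ ob'.
  have jle : row_start i.+1 + i.+2 <= j.
    rewrite [_ + _]addnS -T_lt; have [-> _] := copy i.+1 (leqnn _).
    by rewrite Tj ltrD2r T_lt bE.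
  (* After the last copy, an opening would leave the row without new column, and a cell would have
     no event one time unit before it. *)
  have nw' : is_new (a (row_start i.+1 + i.+2)).
    case/or3P: (letter_cases (a (row_start i.+1 + i.+2))) => // ae.
      have [m mlt] := s5 (row_start i.+1) (row_start i.+1 + i.+2) ltac:(lia) ob' ae.
      have [_ /(_ ltac:(lia))] := copy (m - row_start i.+1) ltac:(lia).
      by rewrite subnKC; [case/cellN/andP => /negbTE -> /negbTE ->|lia].
    have lt1 : (row_start i + i.+1).+1 < row_start i.+1 + i.+2 by rewrite -bE; lia.
    have := s9 _ _ lt1 ae; rewrite -bE.
    have : (T (row_start i.+1 + i.+1) < T (row_start i.+1 + i.+2))%R by rewrite T_lt; lia.
    have [-> _] := copy i.+1 (leqnn _).
    have jne : j != row_start i.+1 + i.+2.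
      by apply: contraTneq oj => ->; case/andP: (cellN _ ae).
    have : (T (row_start i.+1 + i.+2) < T j)%R by rewrite T_lt ltn_neqAle eq_sym jne.
    by rewrite Tj; lra.
  split=> //.
  - move=> p /andP[p0 pi]; have [Tp cp] := copy p pi; split; first exact: cp.
    rewrite Tp; move: pi; rewrite leq_eqVlt => /orP[/eqP->|pi].
      by rewrite /psi -[i.+2%:R%R]natr1; lra.
    have [_ ->] := cells p ltac:(lia).
    by rewrite -[i.+2%:R%R]natr1; lra.
  - have oe := s4 _ nw'; rewrite -addnS -row_startS in oe; split=> //.
    have lt2 : row_start i.+1 < row_start i.+2 by rewrite [row_start i.+2]row_startS; clear; lia.
    have le2 : (T (row_start i.+2) <= T (row_start i.+1) + 1)%R.
      rewrite -Tj T_le [row_start i.+2]row_startS addnS ltn_neqAle jle andbT.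
      by apply: contraTneq oj => <-; case/andP: (newN _ nw').
    by rewrite (next_open _ ob' _ lt2 oe le2) Tb' natr1.
pose L i k := if a (row_start i + k.+1) is Some (Some s) then s else finset.set0.
exists L, psi; have TE i p : p <= i.+1 -> T (row_start i + p) = (i.+1%:R + psi p)%R.
  have [[Tb _] cells _ _] := rows i; case: p => [|p] pi; first by rewrite addn0 Tb addr0.
  move: pi; rewrite leq_eqVlt => /orP[/eqP[->]|pi]; first by rewrite addrC subrK.
  by have [] := cells p.+1 pi.
split=> //.
- move=> p; have : (T (row_start p + p) < T (row_start p + p.+1))%R by rewrite T_lt; lia.
  by rewrite !TE // ltrD2l.
- case=> [|p]; first exact: ltr01.
  have [_ _ _ [Tb _]] := rows p; rewrite /psi.
  have : (T (row_start p + p.+1) < T (row_start p.+1))%R by rewrite T_lt row_lt.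
  by rewrite Tb -[p.+2%:R%R]natr1; lra.
move=> i p pi; split; first exact: TE.
have [[_ ob] cells nw _] := rows i; case: p pi => [|k] ki; first by rewrite addn0; exact/eqP.
rewrite /grid_at; case: eqP => [->|/eqP ne]; first exact/eqP.
have [] := cells k.+1 ltac:(lia).
by rewrite /L; case: (a _) => [[]|].
Qed.

Section GridFacts.

Variables (L : nat -> nat -> {set N}) (psi : nat -> R).
Hypothesis gridL : grid L psi.

Lemma grid_time i p : p <= i.+1 -> T (row_start i + p) = (i.+1%:R + psi p)%R.
Proof. by case: gridL => _ _ _ H /H[]. Qed.

Lemma grid_letterE i p : p <= i.+1 -> a (row_start i + p) = grid_at L i p.
Proof. by case: gridL => _ _ _ H /H[]. Qed.

Lemma psi_lt p q : (psi p < psi q)%R = (p < q).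
Proof. by case: gridL => _ H _ _; have /leW_mono := (le_mono (homo_ltn lt_trans H)); apply. Qed.

Lemma psi_ge0 p : (0 <= psi p)%R.
Proof.
case: gridL => <- _ _ _; case: p => // p; apply/ltW; by rewrite psi_lt.
Qed.

Lemma psi_lt1 p : (psi p < 1)%R.
Proof. by case: gridL. Qed.

Lemma grid_frac i p j q : (i%:R + psi p = j%:R + psi q)%R -> i = j /\ p = q.
Proof.
move=> E; have ij : i = j.
  have := psi_ge0 p; have := psi_ge0 q; have := psi_lt1 p; have := psi_lt1 q => *.
  by apply/eqP; rewrite eqn_leq; apply/andP; split;
    rewrite -ltnS -(ltr_nat R) -[_.+1%:R%R]natr1; lra.
split=> //; move: E; rewrite ij => /addrI E.
by case: (ltngtP p q) => //; rewrite -psi_lt E ltxx.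
Qed.

Lemma grid_event e i p : T e = (i.+1%:R + psi p)%R -> p <= i.+1 /\ e = row_start i + p.
Proof.
have [j [q [qj ->]]] := row_coord e; rewrite grid_time // => /grid_frac[[<-] <-].
by split.
Qed.

Lemma grid_open i p : p <= i.+1 -> is_open (a (row_start i + p)) = (p == 0).
Proof. by move=> /grid_letterE ->; case: p => //= p; case: ifP. Qed.

Lemma grid_structured : structured.
Proof.
have [psi0 _ _ _] := gridL.
split; first by have := @grid_time 0 0 isT; rewrite row_start0 psi0 addr0.
split; first by have := @grid_open 0 0 isT; rewrite row_start0 => ->.
split; first by have := @grid_letterE 0 1 isT; rewrite row_start0 => ->.
split.
  move=> e; have [i [p [pi ->]]] := row_coord e; rewrite grid_letterE //.
  case: p pi => [|p] pi //=; case: eqP => // -> _.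
  by rewrite -addnS -row_startS -[row_start _]addn0 grid_open.
split.
  move=> e e'; have [i [p [pi ->]]] := row_coord e; have [j [q [qj ->]]] := row_coord e'.
  rewrite !grid_open // => lt /eqP p0 /eqP q0; rewrite p0 q0 !addn0 in lt *.
  have ij : i < j.
    rewrite ltnNge; apply/negP; rewrite leq_eqVlt => /orP[/eqP E|ji].
      by rewrite E ltnn in lt.
    by have := @row_lt j i 0 isT ji; lia.
  exists (row_start i + i.+1); first by rewrite row_lt // andbT; lia.
  by rewrite grid_letterE // /= eqxx orbT.
split.
  move=> e; have [i [p [pi ->]]] := row_coord e; exists (row_start i.+1 + p).
    by apply: leq_trans (row_lt pi (ltnSn i)) _; exact: leq_addr.
  by rewrite !grid_time ?(leqW pi) // -[i.+2%:R%R]natr1 addrAC.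
split.
  move=> e e' _; have [i [p [pi ->]]] := row_coord e; rewrite (grid_time pi) addrAC natr1.
  case/grid_event => pi' ->; rewrite grid_open // [X in if _ then X else _]grid_open //.
  case: eqP => // /eqP p0; rewrite grid_letterE //.
  clear pi'; case: p p0 pi => //= p _ pi; case: eqP => // E; lia.
split.
  move=> e e' lt; have [i [p [pi eE]]] := row_coord e; have [j [q [qj e'E]]] := row_coord e'.
  rewrite eE e'E !grid_open // => /eqP p0 /eqP q0; rewrite !grid_time // p0 q0 psi0 !addr0.
  have ij : i < j.
    rewrite ltnNge; apply/negP; rewrite leq_eqVlt => /orP[/eqP E|ji].
      by rewrite eE e'E p0 q0 E ltnn in lt.
    by have := @row_lt j i 0 isT ji; rewrite eE e'E p0 q0 in lt; lia.
  by move: ij; rewrite -(ler_nat R) -[i.+1%:R%R]natr1 -[j.+1%:R%R]natr1; lra.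
move=> e e' lt; have [j [q [qj e'E]]] := row_coord e'.
rewrite e'E grid_letterE //; case: q qj e'E => //= q qj e'E; case: eqP => //= qj' _ Te.
rewrite leNgt; apply/negP => Te'.
case: j qj qj' e'E Te Te' => [|j] qj qj' e'E; first by lia.
have qj1 : q.+1 <= j.+1 by lia.
have -> : T (row_start j.+1 + q.+1) = (T (row_start j + q.+1) + 1)%R.
  by rewrite !grid_time // -[j.+2%:R%R]natr1 addrAC.
move=> Te Te'; have : e < row_start j + q.+1 by rewrite -T_lt; lra.
have : row_start j + q.+1 < e.+1 by rewrite -T_lt; lra.
by lia.
Qed.

End GridFacts.

End Grid.

(** * Detecting the violations of a triangle in a grid *)

Section GridChains.

Variables (N : finType) (n : nat).
Local Notation Sg := (grid_letter N).
Implicit Types (P Q : pred Sg).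

Definition structure_chains : seq (chain Sg n) := [::
  first_time Sg n; first_letter n (predC (@is_open N)); second_letter n (predC (@is_new N));
  untimed2 n (@is_new N) pred0 (predC (@is_open N));
  untimed2 n (@is_open N) (fun l => ~~ is_open l && ~~ is_new l) (@is_open N);
  no_copy Sg n;
  timed_pair (@is_open N) (GCmp (clock0 n) CEq 1) (predC (@is_open N));
  timed_pair (predC (@is_open N)) (GCmp (clock0 n) CEq 1) (predC (@is_cell N));
  timed_pair (@is_open N) (GCmp (clock0 n) CLt 1) (@is_open N);
  gap n (@is_cell N)].

(* Two columns are followed through the rows by resetting the clock of a column
   at each of its events. *)
Definition track : seq (edge Sg n) :=
  [:: skip n predT; Edge predT (Some (GCmp (clock0 n) CEq 1)) [set clock0 n];
      Edge predT (Some (GCmp (clock1 n) CEq 1)) [set clock1 n]].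

(** No opening separates [P1] from [Q1], so they lie in one row; [P2] and [Q2] are tested in the
    same columns of a common later row. The guard [o] is read before any reset, when a clock shows
    the time elapsed since the start. *)
Definition rectangle (o : option (guard n.+2)) P1 Q1 P2 Q2 : chain Sg n :=
  Chain [:: ([:: skip n predT], Edge P1 o [set clock0 n]);
            ([:: skip n (predC (@is_open N))], start Q1 (clock1 n));
            (track, test P2 (GCmp (clock0 n) CEq 1));
            ([:: skip n predT], test Q2 (GCmp (clock1 n) CEq 1))]
    [:: skip n predT].

(** At clock value one the first final loop is disabled, so each event of the guessed column must
    take the resetting loop, which refuses [b]. *)
Definition never (b : N) : chain Sg n :=
  Chain [:: ([:: skip n predT], start (predC (@is_open N)) (clock0 n))]
    [:: test predT (GNot (GCmp (clock0 n) CEq 1));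
        Edge (predC (has_bit b)) (Some (GCmp (clock0 n) CEq 1)) [set clock0 n]].

Variables (R : realType) (x : nat) (T : nat -> R) (a : nat -> Sg).
Hypothesis T_incr : forall i, (T i < T i.+1)%R.

Lemma structure_chainsP :
  (forall c, List.In c structure_chains -> ~ accepts x T a c 0 (fun=> 0%R)) <->
  structured T a.
Proof.
split=> [H|[s1 [s2 [s3 [s4 [s5 [s6 [s7 [s8 s9]]]]]]]] c].
  have {}H i : i < size structure_chains ->
      ~ accepts x T a (nth (first_time Sg n) structure_chains i) 0 (fun=> 0%R).
    move=> ilt; apply: H; elim: structure_chains i ilt => //= c s IH [|i] ilt; first by left.
    by right; apply: IH.
  split; first by apply: contrapT => T0; apply: (H 0) => //; apply/first_timeP.
  split; first by apply/negPn/negP => a0; apply: (H 1) => //; apply/first_letterP.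
  split; first by apply/negPn/negP => a0; apply: (H 2) => //; apply/second_letterP.
  split.
    move=> i ai; apply/negPn/negP => ai1; apply: (H 3) => //; apply/untimed2P.
    by exists i, i.+1; split=> // m; lia.
  split.
    move=> i j ij oi oj; apply: contrapT => C; apply: (H 4) => //; apply/untimed2P.
    exists i, j; split=> // m mij; rewrite -negb_or; apply/negP => om.
    by apply: C; exists m.
  split.
    move=> i; apply: contrapT => C; apply: (H 5) => //; apply/no_copyP.
    by exists i => j ij Tj; apply: C; exists j.
  split.
    move=> i j ij Tj; case: ifP => oi; apply/negPn/negP => aj.
      apply: (H 6) => //; apply/timed_pairP; exists i, j; split=> //=.
      by rewrite Tj addrC addKr eqxx.
    apply: (H 7) => //; apply/timed_pairP; exists i, j; split=> //=; first by rewrite oi.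
    by rewrite Tj addrC addKr eqxx.
  split.
    move=> i j ij oi oj; rewrite leNgt; apply/negP => Tij.
    by apply: (H 8) => //; apply/timed_pairP; exists i, j.
  move=> i j ij cj Tij; rewrite leNgt; apply/negP => Tij'.
  by apply: (H 9) => //; apply/gapP; exists i, j.
case=> [<-|]; first by move/first_timeP.
case=> [<-|]; first by move/first_letterP; rewrite /= s2.
case=> [<-|]; first by move/second_letterP; rewrite /= s3.
case=> [<-|].
  move/untimed2P => [i [j [ij ni nj H]]].
  case: (ltngtP i.+1 j) => ij'; [by have := H i.+1; rewrite ltnSn ij' => /(_ isT)|lia|].
  by move: nj; rewrite -ij' /= s4.
case=> [<-|].
  move/untimed2P => [i [j [ij oi oj H]]]; have [m mij] := s5 i j ij oi oj.
  by have := H m mij; rewrite -negb_or => /negbTE ->.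
case=> [<-|].
  by move/no_copyP => [i H]; have [j ij Tj] := s6 i; exact: (H j ij).
case=> [<-|].
  move/timed_pairP => [i [j [ij oi nj /= /eqP Tj]]]; have := s7 i j ij ltac:(lra).
  by rewrite oi; apply/negP.
case=> [<-|].
  move/timed_pairP => [i [j [ij oi nj /= /eqP Tj]]]; have := s7 i j ij ltac:(lra).
  by rewrite (negbTE oi); apply/negP.
case=> [<-|].
  by move/timed_pairP => [i [j [ij oi oj /= Tj]]]; have := s8 i j ij oi oj; lra.
case=> [<-|//].
by move/gapP => [i [j [ij cj T1 T2]]]; have := s9 i j ij cj T1; lra.
Qed.

Variables (L : nat -> nat -> {set N}) (psi : nat -> R).
Hypothesis gridL : grid T a L psi.

Let T_ltE := T_lt T_incr.

Lemma row_order i p j q : p <= i.+1 -> q <= j.+1 ->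
  (row_start i + p < row_start j + q) = (i < j) || (i == j) && (p < q).
Proof.
move=> pi qj; case: (ltngtP i j) => ij /=.
- by rewrite (leq_trans (row_lt pi ij)) // leq_addr.
- by apply/negbTE; rewrite -leqNgt; have := row_lt qj ij; lia.
- by rewrite ij ltn_add2l.
Qed.

Lemma same_row i p e : p <= i.+1 -> row_start i + p < e -> ~~ is_open (a e) ->
  (forall m, row_start i + p < m < e -> ~~ is_open (a m)) ->
  exists2 q, p < q <= i.+1 & e = row_start i + q.
Proof.
move=> pi; have [j [q [qj ->]]] := row_coord e.
rewrite row_order // => /orP[ij|/andP[/eqP ij pq] _ _]; last by subst j; exists q; rewrite ?pq.
move=> oe H; have : is_open (a (row_start j)) by have := grid_open gridL (leq0n j.+1); rewrite addn0 eqxx.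
case: (posnP q) => [q0|q0]; first by move: oe; rewrite q0 addn0 => /negbTE ->.
have lt : row_start i + p < row_start j < row_start j + q by rewrite row_lt //; lia.
by rewrite (negbTE (H _ lt)).
Qed.

Lemma grid_untimed2P P1 P2 r : P1 None = false -> P2 None = false ->
  accepts x T a (untimed2 n P1 (predC (@is_open N)) P2) 0 r <->
  exists i p q, [/\ 0 < p, p < q <= i.+1, P1 (grid_at L i p) & P2 (grid_at L i q)].
Proof.
move=> N1 N2; rewrite untimed2P; split=> [[e [e' [lt P1e P2e' H]]]|].
  have [i [p [pi E]]] := row_coord e; rewrite {e}E in lt P1e H.
  have o' : ~~ is_open (a e') by apply: contraTN P2e' => /eqP ->; rewrite N2.
  have [q pq E] := same_row pi lt o' H; subst e'.
  move: P1e P2e'; rewrite !(grid_letterE gridL) //; last by case/andP: pq.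
  move=> P1e P2e; exists i, p, q; split=> //.
  by clear -P1e N1; case: p P1e => //; rewrite /= N1.
move=> [i [p [q [p0 /andP[pq qi] P1e P2e]]]]; exists (row_start i + p), (row_start i + q).
have pi := leq_trans (ltnW pq) qi.
rewrite ltn_add2l !(grid_letterE gridL) //; split=> // m /andP[m1 m2].
have -> : m = row_start i + (m - row_start i) by lia.
by rewrite /= (grid_open gridL); lia.
Qed.

Lemma loops_track i p q r m : p < q <= i.+1 ->
  r (clock0 n) = T (row_start i + p) -> r (clock1 n) = T (row_start i + q) ->
  exists2 r', loops x T a track (row_start i + q).+1 r (row_start (i + m.+1) + p) r' &
    r' (clock0 n) = T (row_start (i + m) + p) /\ r' (clock1 n) = T (row_start (i + m) + q).
Proof.
move=> /andP[pq qi] r0 r1; have pi : p <= i.+1 by lia.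
have skip_track e e' s : e <= e' -> loops x T a track e s e' s.
  by move=> ee'; apply: (@loops_skipI _ _ _ _ _ _ track predT) => //; left.
elim: m => [|m [r' lp [r0' r1']]].
  exists r; rewrite ?addn0 //; apply: skip_track; rewrite addn1.
  by rewrite row_order //; lia.
have pm : p <= (i + m.+1).+1 by lia.
have qm : q <= (i + m.+1).+1 by lia.
have dT s : s <= (i + m).+1 -> (T (row_start (i + m.+1) + s) - T (row_start (i + m) + s))%R = 1%R.
  by move=> si; rewrite !(grid_time gridL) //; [rewrite addnS -[(i + m).+2%:R%R]natr1; lra|lia].
pose r1'' := edge_upd T (Edge predT (Some (GCmp (clock0 n) CEq 1)) [set clock0 n] : edge Sg n)
  (row_start (i + m.+1) + p) r'.
pose r2'' := edge_upd T (Edge predT (Some (GCmp (clock1 n) CEq 1)) [set clock1 n] : edge Sg n)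
  (row_start (i + m.+1) + q) r1''.
exists r2''; last first.
  by rewrite /r2'' /r1'' /edge_upd /= !finset.in_set1 /=.
apply: (loops_trans lp); apply: (loops_cons (e := Edge predT (Some (GCmp (clock0 n) CEq 1)) [set clock0 n])).
- by right; left.
- by rewrite /edge_ok /= r0' dT //; lia.
apply: (loops_trans (skip_track _ (row_start (i + m.+1) + q) _ _)); first by lia.
apply: (loops_cons (e := Edge predT (Some (GCmp (clock1 n) CEq 1)) [set clock1 n])).
- by right; right; left.
- by rewrite /edge_ok /edge_upd /= finset.in_set1 /= r1' dT //; lia.
by apply: skip_track; rewrite row_order //; lia.
Qed.

(** A reset happens only at distance one from the previous one, hence in the same column. Skipping
    an event of the column is possible but harmless: the clock then exceeds one for ever and fails
    the final test. *)
Lemma track_inv i p q e r e' r' : loops x T a track e r e' r' ->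
  (exists2 k, (i <= k)%N & r (clock0 n) = k.+1%:R + psi p)%R ->
  (exists2 k, (i <= k)%N & r (clock1 n) = k.+1%:R + psi q)%R -> (r (clock1 n) < T e)%R ->
  [/\ e <= e', (exists2 k, (i <= k)%N & r' (clock0 n) = k.+1%:R + psi p)%R,
    (exists2 k, (i <= k)%N & r' (clock1 n) = k.+1%:R + psi q)%R & (r' (clock1 n) < T e')%R].
Proof.
elim=> {e r e' r'} [e r k0 k1 lt|e r f e' r' fin ok lp IH [k ik r0] [k' ik' r1] lt].
  by split.
have lt' : (r (clock1 n) < T e.+1)%R by apply: lt_trans lt _.
have {}IH : (exists2 k, (i <= k)%N & edge_upd T f e r (clock0 n) = k.+1%:R + psi p)%R ->
    (exists2 k, (i <= k)%N & edge_upd T f e r (clock1 n) = k.+1%:R + psi q)%R ->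
    (edge_upd T f e r (clock1 n) < T e.+1)%R ->
    [/\ e <= e', (exists2 k, (i <= k)%N & r' (clock0 n) = k.+1%:R + psi p)%R,
      (exists2 k, (i <= k)%N & r' (clock1 n) = k.+1%:R + psi q)%R & (r' (clock1 n) < T e')%R].
  by move=> h1 h2 h3; have [? ? ? ?] := IH h1 h2 h3; split=> //; exact: ltnW.
case: fin ok IH {lp} => [<-|[<-|[<-|//]]] /andP[_ /= ok] IH.
- by apply: IH; rewrite edge_upd0; [exists k|exists k'|].
- apply: IH; rewrite /edge_upd /= finset.in_set1 /=; [exists k.+1|exists k'|] => //.
    exact: leqW.
  by move/eqP: ok; rewrite r0 -[k.+2%:R%R]natr1; lra.
- apply: IH; rewrite /edge_upd /= finset.in_set1 /=; [exists k|exists k'.+1|] => //.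
    exact: leqW.
  by move/eqP: ok; rewrite r1 -[k'.+2%:R%R]natr1; lra.
Qed.

Lemma rectangleP o P1 Q1 P2 Q2 : Q1 None = false ->
  accepts x T a (rectangle o P1 Q1 P2 Q2) 0 (fun=> 0%R) <->
  exists i p q i', [/\ p < q <= i.+1, i < i',
    P1 (grid_at L i p) && guard_sat (fun=> T (row_start i + p)) (edge_guard x (Edge P1 o finset.set0)),
    Q1 (grid_at L i q) & P2 (grid_at L i' p) && Q2 (grid_at L i' q)].
Proof.
move=> NQ1; split.
  rewrite /accepts /= => /acc_skipE[e [_ _ /andP[/= P1e ge]]] /acc_skipE[e' [lt H]].
  rewrite /edge_ok /= andbT => Q1e' /acc_loopsE[f [r [lp /andP[/= P2f /eqP Tf]]]].
  case/acc_skipE => f' [ff' _ /andP[/= Q2f' Tf'] _].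
  have [i [p [pi E]]] := row_coord e; rewrite {e}E in lt P1e ge H lp.
  have o' : ~~ is_open (a e') by apply: contraTN Q1e' => /eqP ->; rewrite NQ1.
  have [q pq E] := same_row pi lt o' H; subst e'.
  have qi : q <= i.+1 by case/andP: pq.
  move: lp => /track_inv -/(_ i p q)[].
  - by exists i => //; rewrite /edge_upd /= !finset.in_set1 /= (grid_time gridL).
  - by exists i => //; rewrite /edge_upd /= !finset.in_set1 /= (grid_time gridL).
  - by rewrite /edge_upd /= !finset.in_set1 /= T_ltE.
  move=> qf [k ik r0] [k' ik' r1] r1f.
  have Tf2 : T f = (k.+2%:R + psi p)%R by rewrite -[k.+2%:R%R]natr1; move: Tf; rewrite r0; lra.
  have Tf2' : T f' = (k'.+2%:R + psi q)%R.
    by move/eqP: Tf'; rewrite edge_upd0 r1 -[k'.+2%:R%R]natr1; lra.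
  have [pk fE] := grid_event gridL Tf2; have [qk f'E] := grid_event gridL Tf2'.
  (* The order of the last reset of [clock1], the test of [P2] and the test of [Q2], together with
     [p < q], leaves a single row for both tests. *)
  have kk' : k = k'.
    have : (k.+2%:R + psi p < k'.+2%:R + psi q)%R by rewrite -Tf2 -Tf2' T_ltE.
    have : (k'.+1%:R + psi q < k.+2%:R + psi p)%R by rewrite -r1 -Tf2.
    rewrite -(grid_time gridL qk) -(grid_time gridL pk) T_ltE row_order //.
    have qk1 : q <= k'.+1 by lia.
    by rewrite -(grid_time gridL qk1) T_ltE row_order //; lia.
  rewrite -{k'}kk' in f'E qk Tf2' ik' r1; rewrite fE f'E in P2f Q2f'.
  exists i, p, q, k.+1; rewrite -!(grid_letterE gridL) // P2f Q2f' Q1e' P1e; split=> //.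
  move: ge; rewrite /edge_guard /=.
  by under eq_fun do rewrite subr0.
move=> [i [p [q [i' [/andP[pq qi] ii' /andP[P1e ge] Q1e /andP[P2f Q2f]]]]]].
have pi : p <= i.+1 by lia.
rewrite /accepts /=; apply: (acc_skipI (j := row_start i + p)) => //.
  rewrite /edge_ok /= (grid_letterE gridL) // P1e /=.
  by under eq_fun do rewrite subr0.
apply: (acc_skipI (j := row_start i + q)); first by rewrite ltn_add2l.
- move=> m /andP[m1 m2]; have -> : m = row_start i + (m - row_start i) by lia.
  by rewrite /= (grid_open gridL); lia.
- by rewrite /edge_ok /= (grid_letterE gridL) // Q1e.
set r := edge_upd _ _ _ _.
have [|||r' lp [r0 r1]] := @loops_track i p q r (i' - i.+1); first by rewrite pq.
- by rewrite /r /edge_upd /= !finset.in_set1.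
- by rewrite /r /edge_upd /= !finset.in_set1.
have i'E : i + (i' - i.+1).+1 = i' by lia.
have dT s : s <= i.+1 -> (T (row_start i' + s) - T (row_start (i + (i' - i.+1)) + s))%R = 1%R.
  move=> si; rewrite !(grid_time gridL); [|lia|lia].
  have E : i'.+1 = (i + (i' - i.+1)).+2 by lia.
  by rewrite E -[(i + _).+2%:R%R]natr1; lra.
have pi' : p <= i'.+1 by lia.
have qi' : q <= i'.+1 by lia.
rewrite i'E in lp; apply: (acc_loopsI lp).
  by rewrite /edge_ok /= (grid_letterE gridL pi') P2f r0 dT /=.
rewrite edge_upd0.
apply: (acc_skipI (j := row_start i' + q)) => //; first by rewrite ltn_add2l.
  by rewrite /edge_ok /= (grid_letterE gridL qi') Q2f r1 dT /=.
exact: acc_sink.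
Qed.

Lemma neverP b r : accepts x T a (never b) 0 r <->
  exists i k, k <= i /\ forall i', i < i' -> b \notin L i' k.
Proof.
split.
  rewrite /accepts /= => /acc_skipE[e [_ _]]; rewrite /edge_ok /= andbT => oe [rs rs0 H].
  have [i [p [pi E]]] := row_coord e; rewrite {e}E in oe H rs0.
  case: p pi oe H rs0 => [|k] ki oe H rs0.
    by rewrite /= (grid_open gridL) in oe.
  exists i, k; split; first by lia.
  have step j : ((T ((row_start i + k.+1).+1 + j) - rs j (clock0 n))%R <> 1%R -> rs j.+1 = rs j) /\
     ((T ((row_start i + k.+1).+1 + j) - rs j (clock0 n))%R = 1%R ->
       rs j.+1 (clock0 n) = T ((row_start i + k.+1).+1 + j) /\
       ~~ has_bit b (a ((row_start i + k.+1).+1 + j))).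
    have [f [[<-|[<-|//]] /andP[/= aj /eqP Tj] ->]] := H j.
      by rewrite edge_upd0; split.
    by split=> // _; rewrite /edge_upd /= finset.in_set1.
  have inv m : rs (row_start (i + m) + k.+1 - (row_start i + k.+1)) (clock0 n) = T (row_start (i + m) + k.+1) /\
      (0 < m -> ~~ has_bit b (a (row_start (i + m) + k.+1))).
    elim: m => [|m [IHm _]].
      by rewrite addn0 subnn rs0 /edge_upd /= finset.in_set1 eqxx.
    have lt1 : row_start i + k.+1 <= row_start (i + m) + k.+1.
      by rewrite leqNgt row_order //; lia.
    have lt2 : row_start (i + m) + k.+1 < row_start (i + m.+1) + k.+1 by rewrite row_order; lia.
    have TE : T (row_start (i + m.+1) + k.+1) = (T (row_start (i + m) + k.+1) + 1)%R.
      by rewrite !(grid_time gridL) ?addnS; [rewrite -[(i + m).+2%:R%R]natr1; lra|lia|lia].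
    (* Before the next event of the column the clock is below one, so nothing is reset. *)
    have const l : row_start (i + m) + k.+1 + l < row_start (i + m.+1) + k.+1 ->
        rs (row_start (i + m) + k.+1 - (row_start i + k.+1) + l) = rs (row_start (i + m) + k.+1 - (row_start i + k.+1)).
      elim: l => [|l IHl] ll; first by rewrite addn0.
      rewrite addnS -IHl; last by lia.
      apply: (step _).1; rewrite IHl; last by lia.
      rewrite IHm => E; move: ll; rewrite -T_ltE TE ltNge.
      have -> : row_start (i + m) + k.+1 + l.+1 =
         (row_start i + k.+1).+1 + (row_start (i + m) + k.+1 - (row_start i + k.+1) + l) by lia.
      by move/negP; apply; lra.
    have := const (row_start (i + m.+1) + k.+1 - (row_start (i + m) + k.+1).+1) ltac:(lia).
    set l := (X in rs X = _) => cl.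
    have lE : (row_start i + k.+1).+1 + l = row_start (i + m.+1) + k.+1 by rewrite /l; lia.
    have [_] := step l; rewrite lE cl IHm TE => /(_ ltac:(lra))[rl al].
    have <- : l.+1 = row_start (i + m.+1) + k.+1 - (row_start i + k.+1) by lia.
    by split.
  move=> i' ii'; have [_] := inv (i' - i); rewrite subnKC ?(ltnW ii') // subn_gt0 => /(_ ii').
  by rewrite (grid_letterE gridL) /=; [case: eqP => //; lia|lia].
move=> [i [k [ki H]]].
have ki1 : k.+1 <= i.+1 by [].
rewrite /accepts /=; apply: (acc_skipI (j := row_start i + k.+1)) => //.
  by rewrite /edge_ok /= (grid_open gridL).
set r0 := edge_upd _ _ _ _.
pose e0 := (row_start i + k.+1).+1.
pose f : edge Sg n := Edge (predC (has_bit b)) (Some (GCmp (clock0 n) CEq 1)) [set clock0 n].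
(* The run resets exactly when the clock equals one. *)
pose rs := fix rs j := if j is j'.+1 then
    if (T (e0 + j') - rs j' (clock0 n) == 1)%R then edge_upd T f (e0 + j') (rs j') else rs j'
  else r0.
have inv j : exists2 m, i <= m & rs j (clock0 n) = (m.+1%:R + psi k.+1)%R.
  elim: j => [|j [m im IH]] /=.
    by exists i => //; rewrite /r0 /edge_upd /= finset.in_set1 eqxx (grid_time gridL).
  case: eqP => Tj; last by exists m.
  exists m.+1; first by lia.
  rewrite /edge_upd /= finset.in_set1 eqxx; rewrite IH in Tj.
  by rewrite -[m.+2%:R%R]natr1; lra.
exists rs => // j /=; case: eqP => Tj.
  exists f; split=> //; first by right; left.
  rewrite /edge_ok /= Tj eqxx andbT; have [m im rE] := inv j.
  have [km ->] : k.+1 <= m.+2 /\ e0 + j = row_start m.+1 + k.+1.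
    by apply: (grid_event gridL); rewrite rE in Tj; rewrite -[m.+2%:R%R]natr1; lra.
  rewrite (grid_letterE gridL) //=; case: eqP => // _.
  by apply: H; lia.
exists (test predT (GNot (GCmp (clock0 n) CEq 1))); rewrite edge_upd0; split=> //; first by left.
by rewrite /edge_ok /=; apply/eqP.
Qed.

End GridChains.

(** * Detectors for the clauses of a triangle *)

Section SystemChains.

Variables (N : finType) (zero idn succ inp : N) (n : nat).
Local Notation Sg := (grid_letter N).

Local Notation nonopen := (predC (@is_open N)).
Definition both (P Q : pred Sg) : pred Sg := fun l => P l && Q l.
Local Notation without b := (predC (has_bit b)).

(** In a record of [k], [zero] marks the cell of value 0, so the presence of [p] there tells whether
    [f p k] vanishes. *)
Definition cond_test z p : pred Sg := fun l => has_bit zero l && (has_bit p l == z).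
Definition cond_bad (e : bool) b c : pred Sg :=
  fun l => if e then has_bit b l != has_bit c l else has_bit b l && has_bit c l.

(** For [Comp] the two columns come in either order or coincide; in the last case the opening plays
    the role of the first column. For [Cond] the offending cell lies after cell 0 or is cell 0. *)
Definition constraint_chains (c : constraint N) : seq (chain Sg n) :=
  match c with
  | Comp a b c =>
      [:: rectangle (Some GTrue) (has_bit b) (has_bit c) (has_bit idn) (without a);
          rectangle (Some GTrue) (has_bit c) (has_bit b) (without a) (has_bit idn);
          rectangle (Some GTrue) (@is_open N) (both (has_bit b) (has_bit c)) predT
            (both (has_bit idn) (without a))]
  | Cond z p e a b =>
      [:: untimed2 n (cond_test z p) nonopen (cond_bad e a b);
          untimed2 n (both (cond_test z p) (cond_bad e a b)) predT predT]
  end.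

Definition name_chains (a : N) : seq (chain Sg n) :=
  [:: untimed2 n (has_bit a) nonopen (has_bit a);
      untimed n (@is_open N) (both nonopen (without a)) (both (has_bit idn) (without a))
        (both nonopen (without a)) (@is_open N)].

(** A [zero] preceded by anything but an opening is outside cell 0. Row [i] opens at time [i.+1] and
    creates column [i], so the guard [None], which excludes the value [x.+1] of a clock not yet
    reset, selects the columns other than [x]. *)
Definition special_chains : seq (chain Sg n) :=
  [:: untimed2 n nonopen pred0 (has_bit zero);
      untimed2 n (has_bit idn) pred0 (without succ);
      rectangle None (@is_open N) (@is_new N) predT (has_bit inp);
      never n idn].

Definition system_chains (cs : seq (constraint N)) : seq (chain Sg n) :=
  special_chains ++ flatten (map name_chains (enum N)) ++ flatten (map constraint_chains cs).

Variables (R : realType) (x : nat) (T : nat -> R) (a : nat -> Sg).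
Hypothesis T_incr : forall i, (T i < T i.+1)%R.
Variables (L : nat -> nat -> {set N}) (psi : nat -> R).
Hypothesis gridL : grid T a L psi.

Local Notation acc c := (accepts x T a c 0 (fun=> 0%R)).

Lemma bit_cell b i k : k < i -> has_bit b (grid_at L i k.+1) = (b \in L i k).
Proof. by move=> ki; rewrite /= ltn_eqF. Qed.

Lemma bit_cellP b i p : p <= i.+1 -> has_bit b (grid_at L i p) ->
  exists k, [/\ p = k.+1, k < i & b \in L i k].
Proof.
case: p => // k ki /=; case: eqP => // /eqP ne bL.
by exists k; split=> //; lia.
Qed.

Lemma next_event e (P : pred Sg) : (exists j, [/\ e < j, P (a j) &
  forall m, e < m < j -> pred0 (a m)]) <-> P (a e.+1).
Proof.
split=> [[j [ej Pj H]]|Pe]; last by exists e.+1; split=> // m; lia.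
case: (ltngtP e.+1 j) => ej'; [by have := H e.+1; rewrite ltnSn ej' => /(_ isT)|lia|].
by rewrite ej'.
Qed.

Lemma twiceP b : acc (untimed2 n (has_bit b) nonopen (has_bit b)) <->
  exists i u u', [/\ u < u', u' < i, b \in L i u & b \in L i u'].
Proof.
rewrite (grid_untimed2P x gridL) //; split.
  move=> [i [p [q [p0 /andP[pq qi] bp bq]]]].
  have [k [pE ki bk]] := bit_cellP (leq_trans (ltnW pq) qi) bp.
  have [k' [qE ki' bk']] := bit_cellP qi bq.
  by exists i, k, k'; split=> //; lia.
move=> [i [u [u' [uu' u'i bu bu']]]]; exists i, u.+1, u'.+1.
by rewrite !bit_cell //; [split=> //; lia|lia].
Qed.

Lemma missingP b :
  acc (untimed n (@is_open N) (both nonopen (without b)) (both (has_bit idn) (without b))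
        (both nonopen (without b)) (@is_open N)) <->
  exists i k, [/\ k < i, idn \in L i k & forall u, u < i -> b \notin L i u].
Proof.
rewrite untimedP; split.
  move=> [e [e' [e'' [[/andP[ee' e'e''] oe /andP[ie' be'] oe''] [H H']]]]].
  have [i [p [pi E]]] := row_coord e; subst e.
  move: oe; rewrite (grid_open gridL) // => /eqP p0; subst p.
  have o' : ~~ is_open (a e') by apply: contraTN ie' => /eqP ->.
  have [|q /andP[q0 qi] E] := same_row gridL pi ee' o'; first by move=> m /H/andP[].
  subst e'; move: ie' be'; rewrite /= (grid_letterE gridL) // => ie' be'.
  have [k [qE ki bk]] := bit_cellP qi ie'.
  exists i, k; split=> // u ui; rewrite -bit_cell // -(grid_letterE gridL); last by lia.
  case: (ltngtP u.+1 q) => uq; last by rewrite uq (grid_letterE gridL).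
    by have /andP[] := H (row_start i + u.+1) ltac:(lia).
  have [j [s [sj E]]] := row_coord e''; subst e''.
  move: oe''; rewrite (grid_open gridL) // => /eqP s0; subst s.
  have ij : i < j by move: e'e''; rewrite (row_order) //; lia.
  have /H'/andP[] // : row_start i + q < row_start i + u.+1 < row_start j + 0.
  by rewrite ltn_add2l uq row_order //; lia.
move=> [i [k [ki ik H]]]; exists (row_start i + 0), (row_start i + k.+1), (row_start i.+1 + 0).
have cells m : 0 < m <= i.+1 -> both nonopen (without b) (a (row_start i + m)).
  case: m => // m /andP[_ mi]; apply/andP; split; first by rewrite /= (grid_open gridL).
  rewrite /= (grid_letterE gridL) //; case: (ltngtP m i) => mi'; [|lia|].
    by rewrite bit_cell // H.
  by rewrite mi' /= eqxx.
rewrite !(grid_open gridL) //; split; first split=> //.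
- by rewrite ltn_add2l /= row_order //; lia.
- rewrite /both; apply/andP; split; first by rewrite (grid_letterE gridL) ?bit_cell //; lia.
  by have /andP[] := cells k.+1 ltac:(lia).
split=> m /andP[m1 m2].
  by have := cells (m - row_start i) ltac:(lia); rewrite subnKC //; lia.
have := cells (m - row_start i); rewrite subnKC; last by lia.
by apply; rewrite row_startS in m2; lia.
Qed.

Lemma zeroP : acc (untimed2 n nonopen pred0 (has_bit zero)) <->
  exists i k, [/\ k < i, zero \in L i k & k <> 0].
Proof.
rewrite untimed2P; split.
  move=> [e [j [ej oe zj H]]]; have /next_event ze : exists j, [/\ e < j, has_bit zero (a j) &
    forall m, e < m < j -> pred0 (a m)] by exists j.
  have [i [p [pi E]]] := row_coord e; subst e.
  move: oe; rewrite /= (grid_open gridL) // => p0.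
  move: pi; rewrite leq_eqVlt => /orP[/eqP E|pi].
    have : is_open (a (row_start i.+1 + 0)) by rewrite (grid_open gridL).
    rewrite addn0 row_startS addnS -E => /eqP E'; by rewrite E' in ze.
  rewrite -addnS (grid_letterE gridL) // in ze.
  have [k [pE ki zk]] := bit_cellP pi ze.
  by exists i, k; split=> //; lia.
move=> [i [k [ki zk k0]]]; exists (row_start i + k).
have kE : k <= i.+1 by lia.
have /next_event[j [? ? ?]] : has_bit zero (a (row_start i + k).+1).
  by rewrite -addnS (grid_letterE gridL) ?bit_cell //; lia.
by exists j; split=> //; rewrite /= (grid_open gridL) //; apply/eqP.
Qed.

Lemma succP : acc (untimed2 n (has_bit idn) pred0 (without succ)) <->
  exists i k, [/\ k < i, idn \in L i k & ~ (k.+1 < i /\ succ \in L i k.+1)].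
Proof.
rewrite untimed2P; split.
  move=> [e [j [ej ie zj H]]]; have /next_event se : exists j, [/\ e < j, without succ (a j) &
    forall m, e < m < j -> pred0 (a m)] by exists j.
  have [i [p [pi E]]] := row_coord e; subst e.
  rewrite (grid_letterE gridL) // in ie; have [k [pE ki ik]] := bit_cellP pi ie; subst p.
  exists i, k; split=> // -[ki' sk]; move: se; rewrite /= -addnS.
  by rewrite (grid_letterE gridL) ?bit_cell ?sk //; lia.
move=> [i [k [ki ik H]]]; exists (row_start i + k.+1).
have /next_event[j [? ? ?]] : without succ (a (row_start i + k.+1).+1).
  rewrite /= -addnS (grid_letterE gridL); last by lia.
  case: (ltngtP k.+1 i) => ki'; [|lia|by rewrite ki' /= eqxx].
  by rewrite bit_cell //; apply/negP => sk; apply: H.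
exists j; split=> //; rewrite (grid_letterE gridL) ?bit_cell //; lia.
Qed.

Lemma inputP : acc (@rectangle N n None (@is_open N) (@is_new N) predT (has_bit inp)) <->
  exists i k, [/\ k < i, inp \in L i k & k <> x].
Proof.
rewrite (rectangleP x T_incr gridL) //; have [psi0 _ _ _] := gridL.
have guardE i : guard_sat (fun=> T (row_start i + 0))
    (edge_guard x (Edge (@is_open N) None finset.set0 : edge Sg n)) = (i != x).
  by rewrite /edge_guard /= (grid_time gridL) // psi0 addr0 eqr_nat eqSS.
split.
  move=> [i [p [q [i' [/andP[pq qi] ii' /andP[op g] nq /andP[_ bq]]]]]].
  have p0 : p = 0 by move: op; rewrite -(grid_letterE gridL) ?(grid_open gridL) => [/eqP//||]; lia.
  subst p; rewrite guardE in g.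
  have qE : q = i.+1 by case: q nq {pq bq} qi => //= q; case: eqP => [->|].
  subst q; rewrite bit_cell // in bq.
  by exists i', i; split=> //; apply/eqP.
move=> [i [k [ki ik kx]]]; exists k, 0, k.+1, i; rewrite guardE bit_cell // ik /= eqxx.
by split=> //; apply/eqP.
Qed.

Lemma compP f b c :
  (forall ch, List.In ch (constraint_chains (Comp f b c)) -> ~ acc ch) <->
  tri_holds zero idn L (Comp f b c).
Proof.
split=> [H|H ch].
  move=> i i' z u ii' zi ui bz cu iz; apply/negPn/negP => fu.
  have zi' := ltn_trans zi ii'; have ui' := ltn_trans ui ii'.
  case: (ltngtP z u) => zu.
  - apply: (H _ (or_introl erefl)); apply/(rectangleP x T_incr gridL) => //.
    exists i, z.+1, u.+1, i'; rewrite /= -/(grid_at L _ _.+1).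
    by rewrite !bit_cell // bz cu iz fu; split=> //; lia.
  - apply: (H _ (or_intror (or_introl erefl))); apply/(rectangleP x T_incr gridL) => //.
    exists i, u.+1, z.+1, i'; rewrite /=.
    by rewrite !bit_cell // bz cu iz fu; split=> //; lia.
  - subst u; apply: (H _ (or_intror (or_intror (or_introl erefl)))).
    apply/(rectangleP x T_incr gridL) => //.
    exists i, 0, z.+1, i'; rewrite /both.
    by rewrite [without f _]/= !bit_cell // bz cu iz fu; split=> //; lia.
case=> [<-|[<-|[<-|//]]] /(rectangleP x T_incr gridL); rewrite ?/both //=.
- move=> /(_ erefl)[i [p [q [i' [/andP[pq qi] ii' /andP[bp _] cq /andP[ip fq]]]]]].
  have pi : p <= i.+1 by lia.
  have [k [pE ki bk]] := bit_cellP pi bp; have [u [qE ui cu]] := bit_cellP qi cq; subst p q.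
  have [ki' ui'] : k < i' /\ u < i' by split; lia.
  move: ip fq; rewrite /= -!/(grid_at L _ _.+1) !bit_cell // => ik.
  by rewrite (H i i' k u).
- move=> /(_ erefl)[i [p [q [i' [/andP[pq qi] ii' /andP[bp _] cq /andP[ip fq]]]]]].
  have pi : p <= i.+1 by lia.
  have [u [pE ui cu]] := bit_cellP pi bp; have [k [qE ki bk]] := bit_cellP qi cq; subst p q.
  have [ki' ui'] : k < i' /\ u < i' by split; lia.
  move: ip fq; rewrite /= -!/(grid_at L _ _.+1) !bit_cell // => + ik.
  by rewrite (H i i' k u).
- move=> /(_ erefl)[i [p [q [i' [/andP[pq qi] ii' _ /andP[bq cq] /andP[iq fq]]]]]].
  have [k [qE ki bk]] := bit_cellP qi bq; subst q.
  have ki' : k < i' by lia.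
  move: cq iq fq; rewrite /= -!/(grid_at L _ _.+1) !bit_cell // => ck ik.
  by rewrite (H i i' k k).
Qed.

Lemma cond_chainsP z p e b c :
  (forall i k, k < i -> zero \in L i k -> k = 0) ->
  (forall ch, List.In ch (constraint_chains (Cond z p e b c)) -> ~ acc ch) <->
  tri_holds zero idn L (Cond z p e b c).
Proof.
move=> Z.
have testE i k : k < i -> cond_test z p (grid_at L i k.+1) = (zero \in L i k) && ((p \in L i k) == z).
  by move=> ki; rewrite /cond_test !bit_cell.
have badE i k : k < i -> cond_bad e b c (grid_at L i k.+1) =
    ~~ (if e then (b \in L i k) == (c \in L i k) else ~~ ((b \in L i k) && (c \in L i k))).
  by move=> ki; rewrite /cond_bad !bit_cell //; case: (e); rewrite ?negbK.
have test_cell i q : q <= i.+1 -> cond_test z p (grid_at L i q) ->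
    [/\ q = 1, 0 < i, zero \in L i 0 & (p \in L i 0) = z].
  move=> qi tq; have /andP[zq _] := tq; have [k [qE ki zk]] := bit_cellP qi zq; subst q.
  by move: tq; rewrite testE // => /andP[_ /eqP pz]; have k0 := Z _ _ ki zk; subst k.
have bad_cell i q : q <= i.+1 -> cond_bad e b c (grid_at L i q) -> exists2 k, q = k.+1 & k < i.
  move=> qi; rewrite /cond_bad; case: q qi => [|k] ki /=; first by case: (e).
  case: (k =P i) => [_|/eqP ne _]; first by case: (e).
  by exists k => //; lia.
split=> [H|H ch].
  move=> i u ui z0 pz.
  suff : ~~ ~~ (if e then (b \in L i u) == (c \in L i u) else ~~ ((b \in L i u) && (c \in L i u))).
    by rewrite negbK; case: (e) => // /eqP.
  apply/negP => bad; have i0 : 0 < i by lia.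
  (* If [u] is 0, the tested cell and the offending cell are the same event. *)
  case: (posnP u) => [u0|u0].
    subst u; apply: (H _ (or_intror (or_introl erefl))); apply/untimed2P.
    exists (row_start i + 1), (row_start i + 1).+1; split=> //.
    by rewrite /both (grid_letterE gridL) // testE // badE // z0 pz eqxx.
  apply: (H _ (or_introl erefl)); apply/(grid_untimed2P x gridL) => //.
    by rewrite /cond_bad /=; case: (e).
  by exists i, 1, u.+1; rewrite testE // badE // z0 pz eqxx; split=> //; lia.
case=> [<-|[<-|//]].
  move/(grid_untimed2P x gridL).
  have -> : cond_bad e b c None = false by rewrite /cond_bad /=; case: (e).
  move=> /(_ erefl erefl)[i [q [q' [q0 /andP[qq qi] tq bq]]]].
  have [_ i0 z0 pz] := test_cell _ _ (leq_trans (ltnW qq) qi) tq.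
  have [k qE ki] := bad_cell _ _ qi bq; subst q'; move: bq; rewrite badE // => /negP; apply.
  by have := H i k ki z0 pz; case: (e) => [->|].
move/untimed2P => [e1 [_ [_ /andP[tq bq] _ _]]].
have [i [q [qi E]]] := row_coord e1; subst e1; rewrite (grid_letterE gridL) // in tq bq.
have [_ i0 z0 pz] := test_cell _ _ qi tq.
have [k qE ki] := bad_cell _ _ qi bq; subst q; move: bq; rewrite badE // => /negP; apply.
by have := H i k ki z0 pz; case: (e) => [->|].
Qed.

Lemma system_chainsP cs :
  (forall c, List.In c (system_chains cs) -> ~ acc c) <->
  triangle zero idn succ inp cs x L.
Proof.
split=> [H|[t1 [t2 [t3 [t4 [t5 [t6 t7]]]]]] c].
  have Hs c : List.In c special_chains -> ~ acc c.
    by move=> cin; apply: H; apply/In_cat; left.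
  have Hn b c : List.In c (name_chains b) -> ~ acc c.
    move=> cin; apply: H; apply/In_cat; right; apply/In_cat; left.
    by apply/In_flatten_map; exists b => //; apply/In_mem; rewrite mem_enum.
  have Hc d c : List.In d cs -> List.In c (constraint_chains d) -> ~ acc c.
    move=> din cin; apply: H; apply/In_cat; right; apply/In_cat; right.
    by apply/In_flatten_map; exists d.
  have Z i k : k < i -> zero \in L i k -> k = 0.
    move=> ki zk; apply: contrapT => k0; apply: (Hs _ (or_introl erefl)).
    by apply/zeroP; exists i, k.
  split.
    move=> i b u u' uu' u'i bu; apply/negP => bu'; apply: (Hn b _ (or_introl erefl)).
    by apply/twiceP; exists i, u, u'.
  split.
    move=> i k b ki ik; apply: contrapT => C; apply: (Hn b _ (or_intror (or_introl erefl))).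
    apply/missingP; exists i, k; split=> // u ui; apply/negP => bu.
    by apply: C; exists u.
  split=> //; split.
    move=> i k ki ik; apply: contrapT => C; apply: (Hs _ (or_intror (or_introl erefl))).
    by apply/succP; exists i, k.
  split.
    move=> i k ki ik; apply: contrapT => C.
    apply: (Hs _ (or_intror (or_intror (or_introl erefl)))).
    by apply/inputP; exists i, k.
  split.
    move=> [f b c|z p e b c] din; first by apply/compP => ch; exact: Hc.
    by apply/cond_chainsP => // ch; exact: Hc.
  move=> i k ki; apply: contrapT => C.
  apply: (Hs _ (or_intror (or_intror (or_intror (or_introl erefl))))).
  apply/(neverP x T_incr gridL); exists i, k; split; first exact: ltnW.
  by move=> i' ii'; apply/negP => ik; apply: C; exists i'.
case/In_cat => [|/In_cat[]].
- case=> [<-|[<-|[<-|[<-|//]]]].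
  + by case/zeroP => i [k [ki zk]]; apply; exact: t3 zk.
  + by case/succP => i [k [ki ik]]; apply; exact: t4.
  + by case/inputP => i [k [ki ik]]; apply; exact: t5 ik.
  + case/(neverP x T_incr gridL) => i [k [ki H]].
    (* Row [i.+1] is used because the guessed column may be the one created in row [i], which is a
       cell only from the next row on. *)
    have [i' ii' ik] := t7 i.+1 k ki.
    by have := H i' (ltnW ii'); rewrite ik.
- case/In_flatten_map => b _ [<-|[<-|//]].
  + case/twiceP => i [u [u' [uu' u'i bu bu']]].
    by have := t1 i b u u' uu' u'i bu; rewrite bu'.
  + case/missingP => i [k [ki ik H]]; have [u ui bu] := t2 i k b ki ik.
    by have := H u ui; rewrite bu.
- case/In_flatten_map => -[f b d|z p e b d] din; have := t6 _ din.
    by move/compP; apply.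
  by move/(cond_chainsP z p e b d t3); apply.
Qed.

End SystemChains.

(** * A lower bound on the number of clocks *)

Section ClockBound.

Variables (R : realType) (k n : nat) (B : tba k n).

Definition same_cmp (C : nat) (u u' : R) : Prop :=
  forall op c, c <= C -> cmp_sat u op c = cmp_sat u' op c.

Lemma cmp_sat_gt (u : R) op c : (c%:R < u)%R ->
  cmp_sat u op c = match op with CGe | CGt => true | _ => false end.
Proof.
by move=> cu; case: op => /=; rewrite ?cu ?(ltW cu) ?(gt_eqF cu) // ?(lt_gtF cu) // leNgt cu.
Qed.

Lemma cmp_sat_lt (u : R) op c : (u < c%:R)%R ->
  cmp_sat u op c = match op with CLe | CLt => true | _ => false end.
Proof.
by move=> uc; case: op => /=; rewrite ?uc ?(ltW uc) ?(lt_eqF uc) // ?(lt_gtF uc) // leNgt uc.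
Qed.

Lemma same_cmp_interval C m (u u' : R) : (m%:R < u < m.+1%:R)%R -> (m%:R < u' < m.+1%:R)%R ->
  same_cmp C u u'.
Proof.
move=> /andP[mu um] /andP[mu' um'] op c _; have [cm|mc] := leqP c m.
  have cmR : (c%:R <= m%:R :> R)%R by rewrite ler_nat.
  by rewrite !cmp_sat_gt // (le_lt_trans cmR).
have mcR : (m.+1%:R <= c%:R :> R)%R by rewrite ler_nat.
by rewrite !cmp_sat_lt // (lt_le_trans _ mcR).
Qed.

Lemma same_cmp_large C (u u' : R) : (C%:R < u)%R -> (C%:R < u')%R -> same_cmp C u u'.
Proof.
move=> Cu Cu' op c cC; have cCR : (c%:R <= C%:R :> R)%R by rewrite ler_nat.
by rewrite !cmp_sat_gt // (le_lt_trans cCR).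
Qed.

Fixpoint guard_max (g : guard n) : nat :=
  match g with
  | GTrue => 0
  | GCmp _ _ c => c
  | GNot g => guard_max g
  | GAnd g h | GOr g h => maxn (guard_max g) (guard_max h)
  end.

Lemma guard_sat_same C (v v' : 'I_n -> R) g : guard_max g <= C ->
  (forall y, same_cmp C (v y) (v' y)) -> guard_sat v g = guard_sat v' g.
Proof.
move=> + H; elim: g => [|y op c|g IHg|g IHg h IHh|g IHg h IHh] //=.
- exact: H.
- by move/IHg->.
- by rewrite geq_max => /andP[/IHg-> /IHh->].
- by rewrite geq_max => /andP[/IHg-> /IHh->].
Qed.

Definition max_constant := \max_(e <- trans B) guard_max (tguard e).

Lemma guard_max_le e : List.In e (trans B) -> guard_max (tguard e) <= max_constant.
Proof.
rewrite /max_constant; elim: (trans B) => //= f s IH [->|/IH H]; rewrite big_cons leq_max ?leqnn //.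
by rewrite H orbT.
Qed.

Fixpoint last_reset (Z : nat -> {set 'I_n}) (j : nat) (y : 'I_n) : option nat :=
  if j is j'.+1 then if y \in Z j' then Some j' else last_reset Z j' y else None.

Definition reset_time (T : nat -> R) (o : option nat) : R := if o is Some r then T r else 0%R.

Lemma last_reset_lt Z j y r : last_reset Z j y = Some r -> r < j.
Proof.
elim: j => //= j IHj; case: ifP => _; first by case=> ->.
by move/IHj => /ltnW.
Qed.

Lemma last_reset_mem Z j y r : last_reset Z j y = Some r -> y \in Z r.
Proof. by elim: j => //= j IHj; case: ifP => [yZ [<-]|]. Qed.

Lemma last_reset_ge (Z : nat -> {set 'I_n}) j (y : 'I_n) r : y \in Z r -> r < j ->
  exists2 r', r <= r' & last_reset Z j y = Some r'.
Proof.
move=> yZ; elim: j => // j IHj; rewrite ltnS leq_eqVlt => /orP[/eqP<-|/IHj[r' rr' E]] /=.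
  by exists r; rewrite ?yZ.
by case: ifP => _; [exists j => //; apply: leq_trans rr' _; apply/ltnW/(last_reset_lt E)|exists r'].
Qed.

Lemma time_beforeE (t : nat -> R) (a : nat -> 'I_k) j :
  time_before (word_of t a) j = if j is j'.+1 then t j' else 0%R.
Proof.
case: j => [|j]; first exact: time_before0.
by rewrite -/(event_time _ j) event_time_word_of.
Qed.

Lemma delay_reset_time (t : nat -> R) (a : nat -> 'I_k) (s : nat -> 'I_n -> option nat) j :
  delay (fun y => time_before (word_of t a) j - reset_time t (s j y))%R (word_of t a j).1 =
  fun y => (t j - reset_time t (s j y))%R.
Proof.
by apply/funext => y; rewrite /delay addrAC -event_timeE event_time_word_of.
Qed.

(** The same transitions are taken at the new times: they fix the resets, and their guards only
    compare the times since the last resets with constants. *)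
Lemma transfer_run (t t' : nat -> R) (a : nat -> 'I_k) (q : nat -> 'I_(nstates B))
    (e : nat -> transition k n (nstates B)) (v : nat -> 'I_n -> R) :
  q 0 \in initial B -> v 0 = (fun=> 0%R) ->
  (forall j, [/\ List.In (e j) (trans B), src (e j) = q j /\ dst (e j) = q j.+1,
     letter (e j) = a j, guard_sat (delay (v j) (word_of t a j).1) (tguard (e j))
     & v j.+1 = reset (delay (v j) (word_of t a j).1) (resets (e j))]) ->
  (forall j y, let o := last_reset (fun i => resets (e i)) j y in
     same_cmp max_constant (t j - reset_time t o)%R (t' j - reset_time t' o)%R) ->
  exists v', is_run (word_of t' a) q v'.
Proof.
move=> q0 v0 step same; pose lr := last_reset (fun i => resets (e i)).
have vE j : v j = fun y => (time_before (word_of t a) j - reset_time t (lr j y))%R.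
  elim: j => [|j IHj]; first by apply/funext => y; rewrite v0 time_before0 subrr.
  have [_ _ _ _ ->] := step j; rewrite IHj delay_reset_time; apply/funext => y.
  rewrite /reset time_beforeE /lr /=; case: ifP => _ //=.
  by rewrite subrr.
exists (fun j y => time_before (word_of t' a) j - reset_time t' (lr j y))%R; split=> //.
  by apply/funext => y; rewrite time_before0 subrr.
move=> j; exists (e j); have [ein sd le g _] := step j; split=> //.
  rewrite delay_reset_time; rewrite vE delay_reset_time in g.
  rewrite -(guard_sat_same (C := max_constant) (v := fun y => t j - reset_time t (lr j y))%R) //.
  exact: guard_max_le.
rewrite delay_reset_time; apply/funext => y; rewrite /reset time_beforeE /lr /=.
by case: ifP => _ //=; rewrite subrr.
Qed.

Variables (w0 : nat -> R * 'I_k).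
Hypothesis w0_timed : timed_word w0.

Let m := n.+1.
(** The first [m] events are placed at the multiples of [delta] inside the open unit interval and
    the next [m] one unit later; the gaps in the prefix leave room for a shift by [delta / 2]. *)
Let delta : R := (m.+1%:R^-1)%R.
Let dl (u : nat) : R := (u%:R * delta)%R.

Let delta_gt0 : (0 < delta)%R.
Proof. by rewrite invr_gt0 ltr0n. Qed.

Let dlS u : (dl u.+1 = dl u + delta)%R.
Proof. by rewrite /dl -natr1 mulrDl mul1r. Qed.

Let dl_le u v : u <= v -> (dl u <= dl v)%R.
Proof. by move=> uv; rewrite ler_pM2r // ler_nat. Qed.

Let dl_gap u v : u < v -> (dl u + delta <= dl v)%R.
Proof. by move=> uv; rewrite -dlS dl_le. Qed.

Let dl_m : (dl m = 1 - delta)%R.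
Proof.
have : (dl m.+1 = 1)%R by rewrite /dl mulfV // pnatr_eq0.
by rewrite dlS; lra.
Qed.

Let dl0 : (dl 0 = 0)%R.
Proof. by rewrite /dl mul0r. Qed.

(** The time of event [m + m]: its distance from the first [m] events, shifted or not, exceeds all
    constants of [B]. The time of [w0] is counted from there. *)
Let big : R := (max_constant%:R + 3)%R.

Definition sample_time (e : nat) : R :=
  if e < m then dl e.+1 else if e < m + m then (1 + dl (e - m).+1)%R
  else (big + time_before w0 (e - (m + m)))%R.

Definition sample_letter (e : nat) : 'I_k :=
  if e <= m + m then (w0 0).2 else (w0 (e - (m + m).+1)).2.

Definition perturb (i : nat) (e : nat) : R :=
  if e == i then (sample_time e + delta / 2)%R else sample_time e.

Let big_ge3 : (3 <= big)%R.
Proof. by rewrite lerDr ler0n. Qed.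

Lemma sample_time_late i : sample_time (m + m + i) = (big + time_before w0 i)%R.
Proof. by rewrite /sample_time !ifF; [congr (_ + time_before _ _)%R; lia|lia|lia]. Qed.

Lemma sample_early e : e < m -> sample_time e = dl e.+1.
Proof. by rewrite /sample_time => ->. Qed.

Lemma sample_mid l : l < m -> sample_time (m + l) = (1 + dl l.+1)%R.
Proof.
move=> lm; rewrite /sample_time ifF; last by lia.
by rewrite ifT; [congr (1 + dl _)%R|]; lia.
Qed.

Lemma sample_gap e : e < m + m -> (sample_time e + delta <= sample_time e.+1)%R.
Proof.
move=> em; have [em1|em1] := ltnP e.+1 m.
  by rewrite /sample_time !ifT ?dlS //; lia.
have [em2|em2] := ltnP e m.
  have -> : e.+1 = m by lia.
  have -> : e = n by lia.
  rewrite /sample_time ltnn subnn ltnSn ifT; last by lia.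
  by rewrite [dl 1]dlS dl0 -[n.+1]/m dl_m; have := delta_gt0; lra.
have [em3|em3] := ltnP e.+1 (m + m).
  have [l lE] : exists l, e = m + l by exists (e - m); lia.
  subst e; rewrite -addnS !sample_mid; [|lia|lia].
  by rewrite [dl l.+2]dlS; lra.
have -> : e.+1 = m + m + 0 by lia.
rewrite sample_time_late time_before0 /sample_time ifF ?ifT; [|lia|lia].
have -> : (e - m).+1 = m by lia.
by have := big_ge3; have := delta_gt0; have := dl_m; lra.
Qed.

Lemma sample_incr e : (sample_time e < sample_time e.+1)%R.
Proof.
have [em|em] := ltnP e (m + m); first by have := sample_gap em; have := delta_gt0; lra.
have -> : e = m + m + (e - (m + m)) by lia.
rewrite -addnS !sample_time_late ltrD2l [ltRHS]/time_before big_ord_recr /=.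
by rewrite ltrDl; exact: w0_timed.
Qed.

Lemma sample_gt0 : (0 < sample_time 0)%R.
Proof. by rewrite /sample_time /= dlS dl0 add0r. Qed.

Lemma word_of_timed (t : nat -> R) (a : nat -> 'I_k) :
  (0 < t 0)%R -> (forall e, (t e < t e.+1)%R) -> timed_word (word_of t a).
Proof. by move=> t0 ti [|i] /=; rewrite ?subr0 // subr_gt0. Qed.

Lemma word_of_suffix (t : nat -> R) i :
  (forall e, m + m <= e -> t e = sample_time e) ->
  word_of t sample_letter ((m + m).+1 + i) = w0 i.
Proof.
move=> tE; rewrite /word_of addSn !tE; [|lia|lia].
rewrite -addnS !sample_time_late /sample_letter ifF; last by lia.
have -> : m + m + i.+1 - (m + m).+1 = i by lia.
rewrite [time_before w0 i.+1]/time_before big_ord_recr /= -/(time_before w0 i).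
by case: (w0 i) => t0 l /=; congr pair; lra.
Qed.

Lemma perturb_incr i e : i < m -> (perturb i e < perturb i e.+1)%R.
Proof.
move=> im; rewrite /perturb; have := delta_gt0; have := sample_incr e.
have [em|em] := ltnP e (m + m).
  by have := sample_gap em; case: ifP; case: ifP; lra.
by rewrite !ifF //; lia.
Qed.

Lemma perturb_gt0 i : i < m -> (0 < perturb i 0)%R.
Proof.
by rewrite /perturb; have := sample_gt0; have := delta_gt0; case: ifP; lra.
Qed.

Lemma time_before_ge0 j : (0 <= time_before w0 j)%R.
Proof. by rewrite /time_before; apply: sumr_ge0 => l _; apply/ltW/w0_timed. Qed.

(** A distance that changes stays strictly between 0 and 1, or between 1 and 2, or beyond
    [max_constant]. The excluded one, from event [i] to event [m + i], is exactly one before the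
    shift. *)
Lemma perturb_same i j o : i < m -> (forall r, o = Some r -> r < j) ->
  ~ (j = m + i /\ o = Some i) ->
  same_cmp max_constant (sample_time j - reset_time sample_time o)%R
    (perturb i j - reset_time (perturb i) o)%R.
Proof.
move=> im oj ne; have d0 := delta_gt0; have dm := dl_m.
have dlm u : u <= m -> (dl u <= 1 - delta)%R by move=> um; rewrite -dm dl_le.
case: (eqVneq j i) => [ji|ji].
  subst j; apply: (@same_cmp_interval _ 0); case: o oj {ne} => [r|] oj /=.
  - have ri := oj r erefl; rewrite !sample_early; [|lia|lia].
    have := @dl_gap r.+1 i.+1 ltac:(lia); have := dlm i.+1 ltac:(lia).
    have := dl_le (leq0n r.+1); rewrite dl0; lra.
  - rewrite subr0 sample_early //; have := dlm i.+1 ltac:(lia); have := @dl_gap 0 i.+1 isT.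
    by rewrite dl0; lra.
  - have ri := oj r erefl; rewrite /perturb eqxx ifF; last by lia.
    rewrite !sample_early; [|lia|lia].
    have := @dl_gap r.+1 i.+1 ltac:(lia); have := dlm i.+1 ltac:(lia).
    have := dl_le (leq0n r.+1); rewrite dl0; lra.
  - rewrite /perturb eqxx subr0 sample_early //; have := dlm i.+1 ltac:(lia); have := @dl_gap 0 i.+1 isT.
    by rewrite dl0; lra.
have -> : perturb i j = sample_time j by rewrite /perturb (negbTE ji).
case: o oj ne => [r|] oj ne //=; rewrite /perturb.
case: eqP => [ri|//]; subst r; have ij := oj i erefl.
have di := dlm i.+1 im; have di0 := @dl_gap 0 i.+1 isT; rewrite dl0 in di0.
rewrite (sample_early im).
have [jm|jm] := ltnP j m.
  rewrite (sample_early jm); apply: (@same_cmp_interval _ 0);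
    have := @dl_gap i.+1 j.+1 ltac:(lia); have := dlm j.+1 ltac:(lia); lra.
have [jmm|jmm] := ltnP j (m + m).
  have jE : j = m + (j - m) by lia.
  rewrite jE sample_mid; last by lia.
  have d1 := dlm (j - m).+1 ltac:(lia); have d2 := @dl_gap 0 (j - m).+1 isT; rewrite dl0 in d2.
  case: (ltngtP (j - m) i) => jmi.
  - apply: (@same_cmp_interval _ 0); have := @dl_gap (j - m).+1 i.+1 ltac:(lia); lra.
  - apply: (@same_cmp_interval _ 1); have := @dl_gap i.+1 (j - m).+1 ltac:(lia); lra.
  - by case: ne; rewrite jE jmi.
have jE : j = m + m + (j - (m + m)) by lia.
rewrite jE sample_time_late.
have b0 := time_before_ge0 (j - (m + m)).
have bE : (big = max_constant%:R + 3)%R by [].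
by apply: same_cmp_large; lra.
Qed.

(** All [m] distances are open at once, since every starting event precedes every closing one;
    measuring them takes [m] clocks, one more than [B] has. *)
Lemma clock_bound :
  ~ (forall w, timed_word w -> (forall i, w ((m + m).+1 + i) = w0 i) ->
      L_omega R B w <->
      (forall i, i < m -> (event_time w (m + i) - event_time w i = 1)%R)).
Proof.
move=> H.
pose w := word_of sample_time sample_letter.
have tw : timed_word w by apply: word_of_timed; [exact: sample_gt0|exact: sample_incr].
have [_ [q [v [[q0 v0 step] inf]]]] : L_omega R B w.
  apply/H => //; first by move=> i; apply: word_of_suffix.
  move=> i im; rewrite event_time_word_of sample_mid // sample_early //.
  by rewrite addrK.
have [e eP] := choice step.
pose Z i := resets (e i).
(* Pigeonhole: otherwise each event [m + i] has a clock last reset at event [i], and these [m]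
   clocks are distinct. *)
have [i im Hi] : exists2 i, i < m & forall y, last_reset Z (m + i) y <> Some i.
  apply: contrapT => C.
  have {}C (i : 'I_m) : exists y, last_reset Z (m + i) y == Some (i : nat).
    apply: contrapT => C'; apply: C; exists i => // y /eqP E.
    by apply: C'; exists y.
  have [f fP] := choice C.
  have : injective f.
    move=> i i' E; apply/val_inj/eqP; rewrite eqn_leq; apply/andP.
    (* If [j' < j], a reset at [j] still precedes event [m + j'], so the last reset before that
       event is not at [j']. *)
    have lt (j j' : 'I_m) : f j = f j' -> (j : nat) <= j'.
      move=> Ej; rewrite leqNgt; apply/negP => jj'.
      have yZ := last_reset_mem (eqP (fP j)).
      have [r jr] := @last_reset_ge Z (m + j') (f j) j yZ (ltn_addr _ (ltn_ord j)).
      by rewrite Ej (eqP (fP j')) => -[E']; lia.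
    by split; apply: lt.
  by move/leq_card; rewrite !card_ord /m ltnn.
have [v' run'] : exists v', is_run (word_of (perturb i) sample_letter) q v'.
  apply: (transfer_run q0 v0 eP) => j y; apply: perturb_same => //.
    by move=> r; exact: last_reset_lt.
  by move=> [jE oE]; apply: (Hi y); rewrite -jE.
pose w' := word_of (perturb i) sample_letter.
have tw' : timed_word w'.
  by apply: word_of_timed; [exact: perturb_gt0|move=> e'; exact: perturb_incr].
have : L_omega R B w' by split=> //; exists q, v'.
rewrite H //; last first.
  by move=> j; apply: word_of_suffix => e' me'; rewrite /perturb ifF //; lia.
move=> /(_ i im); rewrite event_time_word_of /perturb eqxx ifF; last by lia.
by rewrite sample_mid // sample_early //; have := delta_gt0; lra.
Qed.

End ClockBound.

(** * Words without violation *)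

Fixpoint coord (e : nat) : nat * nat :=
  if e is e'.+1 then
    let: (i, p) := coord e' in if p == i.+1 then (i.+1, 0) else (i, p.+1)
  else (0, 0).

Lemma coordK i p : p <= i.+1 -> coord (row_start i + p) = (i, p).
Proof.
elim: i p => [|i IHi]; elim=> [|p IHp] pi.
- by rewrite row_start0.
- by rewrite addnS /= IHp ?(ltnW pi) //= ltn_eqF.
- by rewrite addn0 row_startS addnS /= IHi //= eqxx.
- by rewrite addnS /= IHp ?(ltnW pi) //= ltn_eqF.
Qed.

Section Universality.

Variables (N : finType) (zero idn succ inp : N) (cs : seq (constraint N)) (n : nat).
Variable R : realType.
Local Notation Sg := (grid_letter N).

Definition violation_chains : seq (chain Sg n) :=
  structure_chains N n ++ system_chains zero idn succ inp n cs.

Lemma triangle_violation_free x (T : nat -> R) (a : nat -> Sg) :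
  (forall i, (T i < T i.+1)%R) ->
  (forall c, List.In c violation_chains -> ~ accepts x T a c 0 (fun=> 0%R)) ->
  exists L, triangle zero idn succ inp cs x L.
Proof.
move=> Ti H; have st : structured T a.
  by apply/(structure_chainsP n x) => c cin; apply: H; apply/In_cat; left.
have [L [psi g]] := structured_grid Ti st; exists L.
by apply/(system_chainsP zero idn succ inp n x Ti g) => c cin; apply: H; apply/In_cat; right.
Qed.

(** A strictly increasing sequence from 0 that stays below 1 fits infinitely many columns into one
    time unit. *)
Definition frac (p : nat) : R := (1 - p.+1%:R^-1)%R.

Lemma frac_lt p q : (frac p < frac q)%R = (p < q).
Proof. by rewrite ltrD2l ltrN2 ltf_pV2 ?posrE ?ltr0n // ltr_nat. Qed.

Lemma frac_lt1 p : (frac p < 1)%R.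
Proof. by rewrite ltrBlDr ltrDl invr_gt0 ltr0n. Qed.

Definition grid_word_time (e : nat) : R := ((coord e).1.+1%:R + frac (coord e).2)%R.
Definition grid_word_letter (L : nat -> nat -> {set N}) (e : nat) : Sg :=
  grid_at L (coord e).1 (coord e).2.

Lemma grid_word_incr e : (grid_word_time e < grid_word_time e.+1)%R.
Proof.
have [i [p [pi ->]]] := row_coord e; rewrite /grid_word_time /= coordK //=.
case: eqP => _ /=; last by rewrite ltrD2l frac_lt.
have -> : frac 0 = 0%R by rewrite /frac invr1 subrr.
by rewrite -[i.+2%:R%R]natr1; have := frac_lt1 p; lra.
Qed.

Lemma triangle_word x L : triangle zero idn succ inp cs x L ->
  exists (T : nat -> R) (a : nat -> Sg), [/\ (0 < T 0)%R, forall i, (T i < T i.+1)%R &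
    forall c, List.In c violation_chains -> ~ accepts x T a c 0 (fun=> 0%R)].
Proof.
move=> tri; exists grid_word_time, (grid_word_letter L); split; last first.
- have g : grid grid_word_time (grid_word_letter L) L frac.
    split.
    + by rewrite /frac invr1 subrr.
    + by move=> p; rewrite frac_lt.
    + exact: frac_lt1.
    + by move=> i p pi; rewrite /grid_word_time /grid_word_letter coordK.
  move=> c /In_cat[]; move: c.
    by apply/structure_chainsP; exact: grid_structured grid_word_incr _ _ g.
  exact/(system_chainsP zero idn succ inp n x grid_word_incr g).
- exact: grid_word_incr.
- by rewrite /grid_word_time /= /frac invr1 subrr addr0 ltr0n.
Qed.

End Universality.

(** * Prefixes testing n clocks *)

Section Prefix.

Variables (Sg : finType) (n : nat) (R : realType) (x : nat).
Local Notation clocks := n.+2.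

(** Guards see only the differences [T i - r y], so translating the event times and the reset times
    together changes nothing. *)
Lemma chain_acc_shift (T : nat -> R) (a : nat -> Sg) s (d : R) st fin i (r : 'I_clocks -> R) :
  chain_acc x T a st fin (s + i) r <->
  chain_acc x (fun j => T (s + j) - d)%R (fun j => a (s + j)) st fin i (fun y => r y - d)%R.
Proof.
set T' := fun j => (T (s + j)%N - d)%R; set a' := fun j => a (s + j).
pose sh (r : 'I_clocks -> R) := fun y => (r y - d)%R.
have okE (e : edge Sg n) j r' : edge_ok x T' a' e j (sh r') = edge_ok x T a e (s + j) r'.
  rewrite /edge_ok; congr (_ && guard_sat _ _); apply/funext => y.
  by rewrite /T' /sh opprB addrA subrK.
have updE (e : edge Sg n) j r' : edge_upd T' e j (sh r') = sh (edge_upd T e (s + j) r').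
  by apply/funext => y; rewrite /edge_upd /sh /T'; case: ifP.
have loopE ls j r' j' r'' : loops x T a ls (s + j) r' j' r'' ->
    exists2 l, j' = s + l & loops x T' a' ls j (sh r') l (sh r'').
  move E: (s + j) => sj lp; elim: lp j E => [{}i {}r|{}i {}r e k r1 els ok _ IH] j E.
    by exists j => //; exact: loops_nil.
  have [l lE lp] := IH j.+1 ltac:(lia); exists l => //.
  by subst i; apply: (loops_cons els); rewrite ?okE // updE.
have loopI ls j r' l r'' : loops x T' a' ls j r' l r'' -> forall r1, r' = sh r1 ->
    exists2 r2, r'' = sh r2 & loops x T a ls (s + j) r1 (s + l) r2.
  elim=> [{}i {}r r1 ->|{}i {}r e k r2 els ok _ IH r1 rE]; first by exists r1 => //; exact: loops_nil.
  subst r; rewrite okE in ok; have [r3 r3E lp] := IH (edge_upd T e (s + i) r1) (updE e i r1).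
  by exists r3 => //; apply: (loops_cons els) => //; rewrite -addnS.
elim: st i r => [|[ls e] st IHst] i r; rewrite -/(sh r).
  split=> -[rs r0 H].
    exists (fun j => sh (rs j)); first by rewrite r0.
    move=> j; have [e [ef ok upd]] := H j; exists e; rewrite okE updE addnA.
    by split=> //; rewrite upd.
  exists (fun j y => rs j y + d)%R; first by apply/funext => y; rewrite r0 /sh subrK.
  move=> j; have [e [ef ok upd]] := H j; exists e.
  have rsE : rs j = sh (fun y => rs j y + d)%R by apply/funext => y; rewrite /sh addrK.
  rewrite rsE okE addnA in ok; split=> //; apply/funext => y.
  by rewrite upd {1}rsE updE /sh addnA subrK.
split=> [/acc_loopsE[j [r' [/loopE[l jE lp] ok ac]]]|/acc_loopsE[j [r' [lp ok ac]]]].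
  subst j; apply: (acc_loopsI lp); first by rewrite okE.
  by rewrite updE; apply/IHst; rewrite addnS.
have [r2 r2E lp'] := loopI _ _ _ _ _ lp r erefl; subst r'.
apply: (acc_loopsI lp'); first by rewrite -okE.
by rewrite updE in ac; rewrite -addnS; exact/IHst.
Qed.

Definition clock_edge (j : nat) : edge Sg n :=
  if j < clocks then start predT (inord j)
  else test predT (GCmp (inord (j - clocks)) CEq 1).

Definition clock_chain : chain Sg n :=
  Chain [seq ([:: skip n pred0], clock_edge j) | j <- iota 0 (clocks + clocks)]
    [:: skip n predT].

(** The last edge resets every clock, which makes event [m] the time origin of the chain that
    follows. *)
Definition all_skip (m : nat) : seq (seq (edge Sg n) * edge Sg n) :=
  rcons (nseq m ([:: skip n pred0], skip n predT))
    ([:: skip n pred0], Edge predT (Some GTrue) finset.setT).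

Definition delayed (c : chain Sg n) : chain Sg n :=
  Chain (all_skip (clocks + clocks) ++ chain_steps c) (chain_final c).

Variables (T : nat -> R) (a : nat -> Sg).

Lemma acc_step e st fin i (r : 'I_clocks -> R) :
  chain_acc x T a (([:: skip n pred0], e) :: st) fin i r <->
  edge_ok x T a e i r /\ chain_acc x T a st fin i.+1 (edge_upd T e i r).
Proof.
split=> [/acc_skipE[j [ij H ok ac]]|[ok ac]].
  by rewrite (skip_pred0 ij H) in ok ac.
by apply: (acc_skipI (j := i)) => // m; lia.
Qed.

Lemma delayed_accepts c r : accepts x T a (delayed c) 0 r <->
  accepts x T a c (clocks + clocks).+1 (fun=> T (clocks + clocks)).
Proof.
have H l i r' : chain_acc x T a (rcons (nseq l ([:: skip n pred0], skip n predT))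
      ([:: skip n pred0], Edge predT (Some GTrue) finset.setT) ++ chain_steps c)
    (chain_final c) i r' <->
  chain_acc x T a (chain_steps c) (chain_final c) (i + l).+1 (fun=> T (i + l)).
  elim: l i r' => [|l IHl] i r'.
    rewrite /= acc_step addn0.
    suff -> : edge_upd T (Edge predT (Some GTrue) finset.setT : edge Sg n) i r' = (fun=> T i).
      by split=> [[_ ac]//|ac]; split.
    by apply/funext => y; rewrite /edge_upd /= finset.in_setT.
  rewrite [X in chain_acc _ _ _ X]/= acc_step IHl addnS addSn.
  by split=> [[_ ac]//|ac]; split.
exact: (H (clocks + clocks) 0 r).
Qed.

(** The hypothesis on [r] remembers the resets made so far; the tests preserve it because they reset
    nothing. *)
Lemma clock_chain_acc l j (r : 'I_clocks -> R) : j + l = clocks + clocks ->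
  (forall y : 'I_clocks, y < j -> r y = T y) ->
  chain_acc x T a [seq ([:: skip n pred0], clock_edge j) | j <- iota j l]
    [:: skip n predT] j r <->
  (forall m, m < clocks -> j <= clocks + m -> (T (clocks + m) - T m = 1)%R).
Proof.
elim: l j r => [|l IHl] j r jl rE.
  by split=> [_ m|_]; [lia|exact: acc_sink].
rewrite /= acc_step IHl; [|lia|]; last first.
  move=> y yj; rewrite /edge_upd /clock_edge; case: (ltnP j clocks) => jc /=.
    rewrite finset.in_set1; case: eqP => [->|/eqP ne]; first by rewrite inordK.
    apply: rE; move: ne; rewrite -val_eqE /= inordK //; lia.
  by rewrite finset.in_set0 rE //; have := ltn_ord y; lia.
rewrite /edge_ok /clock_edge; case: (ltnP j clocks) => jc /=.
  by split=> [[_ H] m mc jm|H]; [apply: H => //; lia|split=> // m mc jm; apply: H => //; lia].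
have jc' : j - clocks < clocks by lia.
have rj : r (inord (j - clocks)) = T (j - clocks) by rewrite rE inordK //; lia.
rewrite rj; split=> [[/eqP Hj H] m mc|H].
  rewrite leq_eqVlt => /orP[/eqP E|jm]; last by apply: H => //; lia.
  have mE : m = j - clocks by lia.
  by rewrite mE -mE -E mE.
split; first by have := H (j - clocks) jc' ltac:(lia); rewrite subnKC => [->//|]; lia.
by move=> m mc jm; apply: H => //; lia.
Qed.

Lemma clock_chainP r : accepts x T a clock_chain 0 r <->
  (forall m, m < clocks -> (T (clocks + m) - T m = 1)%R).
Proof.
apply: iff_trans (clock_chain_acc (l := clocks + clocks) (j := 0) (r := r) _ _) _ => //.
by split=> H m mc; [apply: H|move=> _; exact: H].
Qed.

End Prefix.

(** * The reduction *)

(** The automaton with fewer clocks in the case where the reduction accepts every timed word. *)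
Definition trivial_tba (k n : nat) : tba k n :=
  @TBA k n 1 finset.setT finset.setT [seq Transition ord0 l GTrue finset.set0 ord0 | l <- enum 'I_k].

Lemma trivial_tba_language (R : realType) k n (w : nat -> R * 'I_k) :
  timed_word w -> L_omega R (trivial_tba k n) w.
Proof.
move=> tw; split=> //; exists (fun=> ord0), (fun i y => time_before w i).
split; last by move=> j; exists j; rewrite ?finset.in_setT.
split; first by rewrite finset.in_setT.
- by apply/funext => y; rewrite time_before0.
move=> i; exists (Transition ord0 (w i).2 GTrue finset.set0 ord0); split=> //.
- by apply/In_map; exists (w i).2 => //; apply/In_mem; rewrite mem_enum.
- apply/funext => y; rewrite /reset /= finset.in_set0 /delay -event_timeE.
  by [].
Qed.

Section Reduction.

Variables (R : realType) (N : finType) (zero idn succ inp : N).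
Variables (cs : seq (constraint N)) (n : nat).
Local Notation Sg := (grid_letter N).

Definition reduction_chains : seq (chain Sg n) :=
  clock_chain Sg n :: map (@delayed Sg n) (violation_chains zero idn succ inp cs n).

Definition reduction (x : nat) : tba #|Sg| n.+2 := chain_tba reduction_chains x.

Let prefix := (n.+2 + n.+2).+1.

Lemma reduction_language x (w : nat -> R * 'I_#|Sg|) : timed_word w ->
  L_omega R (reduction x) w <->
  (forall m, m < n.+2 -> (event_time w (n.+2 + m) - event_time w m = 1)%R) \/
  exists2 c, List.In c (violation_chains zero idn succ inp cs n) &
    accepts x (event_time (fun i => w (prefix + i))) (event_letter (fun i => w (prefix + i)))
      c 0 (fun=> 0%R).
Proof.
move=> tw; rewrite chain_tba_language.
have TE i : event_time (fun i => w (prefix + i)) i =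
    (event_time w (prefix + i) - event_time w (n.+2 + n.+2))%R.
  elim: i => [|i IHi].
    rewrite event_timeE time_before0 add0r addn0 [event_time w prefix]event_timeE.
    have -> : time_before w prefix = event_time w (n.+2 + n.+2) by [].
    by rewrite addrC addKr.
  have -> : (event_time w (prefix + i.+1) = event_time w (prefix + i) + (w (prefix + i.+1)%N).1)%R.
    by rewrite addnS event_timeE.
  by rewrite event_timeE -/(event_time _ i) IHi addrAC.
have accE (c : chain Sg n) : accepts x (event_time w) (event_letter w) (delayed c) 0 (fun=> 0%R) <->
    accepts x (event_time (fun i => w (prefix + i))) (event_letter (fun i => w (prefix + i)))
      c 0 (fun=> 0%R).
  rewrite delayed_accepts /accepts -[X in chain_acc _ _ _ _ _ X]addn0.
  rewrite (chain_acc_shift _ _ _ _ (event_time w (n.+2 + n.+2))).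
  have -> : (fun y : 'I_n.+2 => event_time w (n.+2 + n.+2) - event_time w (n.+2 + n.+2))%R =
    (fun=> 0%R) by apply/funext => y; rewrite subrr.
  by have -> : event_time (fun i => w (prefix + i)) = (fun j =>
      event_time w (prefix + j) - event_time w (n.+2 + n.+2))%R by apply/funext.
rewrite /reduction_chains; split=> [[_ [c /(@List.in_inv _ _ _ _)[<-|/In_map[c' cin ->]]]]|H].
- by move/clock_chainP; left.
- by move/accE; right; exists c'.
split=> //; case: H => [H|[c cin ac]].
  by exists (clock_chain Sg n); [left|apply/clock_chainP].
exists (delayed c); last exact/accE.
by right; apply/In_map; exists c.
Qed.

Lemma reduction_correct x :
  (exists B : tba #|Sg| n.+1, L_omega R B = L_omega R (reduction x)) <->
  ~ exists L, triangle zero idn succ inp cs x L.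
Proof.
split.
  (* The word of the triangle triggers no detector, so for words with this suffix acceptance amounts
     to the test on the prefix, which [clock_bound] denies to [n.+1] clocks. *)
  move=> [B BE] [L /(triangle_word n R)[T [a [T0 Ti noacc]]]].
  pose w0 : nat -> R * 'I_#|Sg| := word_of T (fun i => enum_rank (a i)).
  have tw0 : timed_word w0 by apply: word_of_timed.
  apply: (@clock_bound R #|Sg| n.+1 B w0 tw0) => w tw suf; rewrite BE reduction_language //.
  have -> : (fun i => w (prefix + i)) = w0 by apply/funext.
  have -> : event_letter w0 = a by apply/funext => i; rewrite /event_letter enum_rankK.
  rewrite event_time_word_of; split=> [[//|[c /noacc]//]|]; by left.
(* Without a triangle some detector accepts the suffix of any given timed word, so the reduction is
   universal. *)
move=> noL; exists (trivial_tba #|Sg| n.+1).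
apply/seteqP; split=> w; last by move=> [tw _]; exact: trivial_tba_language.
move=> [tw _]; apply/reduction_language => //; right; apply: contrapT => C; apply: noL.
apply: (@triangle_violation_free _ _ _ _ _ _ n R x
  (event_time (fun i => w (prefix + i))) (event_letter (fun i => w (prefix + i)))).
  by move=> i; rewrite [ltRHS]event_timeE ltrDl; exact: tw.
by move=> c cin ac; apply: C; exists c.
Qed.

End Reduction.

(* The alphabet (of size k) is part of the instance. *)
Theorem theorem10 (R : realType) (n : nat) (hn : 2 <= n) :
  Pi11_hard
    (fun A : {k : nat & tba k n} => code_tba (projT2 A))
    (fun A : {k : nat & tba k n} =>
       exists B : tba (projT1 A) n.-1, L_omega R B = L_omega R (projT2 A)).
Proof.
case: n hn => [|[|n]] // _ S [p pP].
(* The system is to be solvable exactly when some [F] refutes [p] at [x], hence the negation. *)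
have [m [zero [idn [succ [inp [cs csP]]]]]] := arithmetic_system (FNot p).
pose red := reduction zero idn succ inp (consistent idn cs) n.
exists (fun x => existT (fun k => tba k n.+2) _ (red x)); split; first exact: recursive1_code_chain_tba.
move=> x; rewrite /= reduction_correct pP.
split=> [H [L /triangle_solves/csP[F]]|H F]; first by apply; exact: H.
apply: contrapT => np; apply: H; have /csP[f /solves_triangle[L tri]] : exists F, sat F [:: x] (FNot p).
  by exists F.
by exists L.
Qed.
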